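(* Let $T$ be a tree embedded in a disk. The reduced noncrossing complex $\widetilde\Delta^{NC}(T)$ is pure (any two facets have the same cardinality) and thin (every codimension 1 simplex is a face of exactly two facets).
   Context: $T$ is a tree (finite connected acyclic graph) embedded in a closed disk $D^2$ so that a vertex lies on $\partial D^2$ iff it is a leaf; non-leaf vertices are called interior and every interior vertex has degree at least $3$. The faces of $T$ are the 2-dimensional regions into which $T$ divides $D^2$. An acyclic path is a sequence of vertices $(v_0,\dots,v_t)$ with $v_i,v_j$ adjacent iff $|i-j|=1$; it is identified with its reversal. A segment is an acyclic path with at least two vertices, with non-leaf endpoints, such that any two consecutive edges are incident to a common face. An arc is an acyclic path whose endpoints are distinct leaves and such that any two consecutive edges are incident to a common face. An arc $p$ divides $D^2$ into two components and so partitions the faces of $T$ into two sets, the regions defined by $p$. Arcs $p,q$ cross along a segment $s$ if every vertex of $s$ appears in both $p$ and $q$ and, for all regions $R_p$ of $p$ and $R_q$ of $q$, $R_p\not\subset R_q$ and $R_q\not\subset R_p$; they are noncrossing if they cross along no segment. The noncrossing complex $\Delta^{NC}(T)$ is the simplicial complex whose simplices are the sets of pairwise noncrossing arcs. A boundary arc is an arc whose vertices all lie on a common face of $T$. The reduced noncrossing complex $\widetilde\Delta^{NC}(T)$ is the simplicial complex consisting of the simplices of $\Delta^{NC}(T)$ containing no boundary arcs. *)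

(* Defs.v *)
From mathcomp Require Import all_boot.

Set Implicit Arguments.
Unset Strict Implicit.
Unset Printing Implicit Defensive.

(* A tree embedded in a closed disk, with exactly its leaves on the boundary,
   is given up to orientation-preserving homeomorphism of the disk by the tree
   and its rotation system: [dt_rot v w] is the neighbour of [v] that follows
   [w] in clockwise order around [v].  Conversely every rotation system of a
   tree comes from such an embedding.  Field [dt_rot_cyclic] says that
   [dt_rot v] permutes the neighbours of [v] in a single cycle; its values off
   the neighbours of [v] are irrelevant. *)
Record disk_tree := DiskTree {
  dt_vertex :> finType;
  dt_adj : rel dt_vertex;
  dt_rot : dt_vertex -> dt_vertex -> dt_vertex;
  dt_nonempty : 0 < #|dt_vertex|;
  dt_adj_sym : symmetric dt_adj;
  dt_adj_irr : irreflexive dt_adj;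
  dt_connected : forall x y, connect dt_adj x y;
  dt_acyclic : forall c : seq dt_vertex, ucycle dt_adj c -> size c <= 2;
  dt_rot_adj : forall v w, dt_adj v w -> dt_adj v (dt_rot v w);
  dt_rot_cyclic : forall v w w',
    dt_adj v w -> dt_adj v w' -> fconnect (dt_rot v) w w';
  dt_interior_degree : forall v, #|dt_adj v| != 1 -> 3 <= #|dt_adj v|
}.

Section DiskTree.
Variable T : disk_tree.
Implicit Types (u v w x y : T) (s : seq T) (p q : {set T}).

Definition adj : rel T := @dt_adj T.
Definition cw v : T -> T := dt_rot v.
Definition leaf v := #|adj v| == 1.
Definition interior v := ~~ leaf v.

(* An edge {u, v} has two sides; the pair (u, v) stands for the side on the
   left when travelling from u to v.  At an interior vertex v the left side of
   (u, v) continues as the left side of (v, cw v u), in the same face of the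
   disk; at a leaf the boundary of the disk separates the two sides of the
   pendant edge.  A face is recorded as the set of the edge sides it touches. *)
Definition side : finType := (T * T)%type.

Definition side_next : rel side :=
  fun d d' => [&& adj d.1 d.2, interior d.2 & d' == (d.2, cw d.2 d.1)].

Definition side_adjacent : rel side :=
  fun d d' => side_next d d' || side_next d' d.

Definition face : finType := {set side}.

Definition face_of (d : side) : face := [set d' | connect side_adjacent d d'].

Definition faces : {set face} := [set face_of d | d : side & adj d.1 d.2].

Definition edge_on (F : face) u v := ((u, v) \in F) || ((v, u) \in F).

Definition vertex_on (F : face) v := [exists u, edge_on F u v].

(* Read literally, this also admits (a, b, a); such a sequence is never an arc,
   and as a segment it has the same vertices as (a, b). *)
Definition acyclic_path s :=
  s != [::] /\
  forall x0 i j, i < size s -> j < size s ->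
    adj (nth x0 s i) (nth x0 s j) = (i.+1 == j) || (j.+1 == i).

Definition turns_along_faces s :=
  forall u v w, infix [:: u; v; w] s ->
    exists2 F, F \in faces & edge_on F u v && edge_on F v w.

Definition segment s :=
  [/\ acyclic_path s, turns_along_faces s, 2 <= size s &
      forall x0, interior (head x0 s) /\ interior (last x0 s)].

Definition arc_path s :=
  [/\ acyclic_path s, turns_along_faces s &
      forall x0, [/\ leaf (head x0 s), leaf (last x0 s)
                   & head x0 s != last x0 s]].

(* The vertex set of an arc determines the arc up to reversal, since
   consecutive vertices are exactly the adjacent ones; an arc, identified with
   its reversal, is therefore recorded by its vertex set. *)
Definition arc p := exists2 s, arc_path s & p = [set v in s].

(* For the same reason the edges of the arc p are the edges with both ends in
   p.  Two faces are in the same component of the disk minus p iff one can go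
   from one to the other by crossing edges that are not in p. *)
Definition face_crossing p : rel face :=
  fun F G => [&& F \in faces, G \in faces &
    [exists d : side, [&& adj d.1 d.2, ~~ ((d.1 \in p) && (d.2 \in p)),
                          d \in F & (d.2, d.1) \in G]]].

Definition region_of p (F : face) : {set face} :=
  [set G | connect (face_crossing p) F G].

Definition regions p : {set {set face}} := [set region_of p F | F in faces].

Definition cross_along p q s :=
  [/\ segment s, {subset s <= p}, {subset s <= q} &
      forall Rp Rq, Rp \in regions p -> Rq \in regions q ->
        ~~ (Rp \subset Rq) /\ ~~ (Rq \subset Rp)].

Definition noncrossing p q := forall s, ~ cross_along p q s.

Definition boundary_arc p :=
  arc p /\ exists2 F, F \in faces & {in p, forall v, vertex_on F v}.

Definition noncrossing_complex (S : {set {set T}}) : Prop :=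
  {in S, forall p, arc p} /\
  {in S &, forall p q, p != q -> noncrossing p q}.

Definition reduced_noncrossing_complex (S : {set {set T}}) : Prop :=
  noncrossing_complex S /\ {in S, forall p, ~ boundary_arc p}.

End DiskTree.

Section Complex.
Variables (X : finType) (Delta : {set X} -> Prop).
Implicit Types S F : {set X}.

Definition facet F :=
  Delta F /\ forall S, Delta S -> F \subset S -> S = F.

Definition pure := forall F F', facet F -> facet F' -> #|F| = #|F'|.

Definition codim1 S :=
  [/\ Delta S, exists2 F, Delta F & #|F| = #|S|.+1
    & forall F, Delta F -> #|F| <= #|S|.+1].

Definition thin := forall S, codim1 S ->
  exists F1 F2, F1 != F2 /\
    forall F, (facet F /\ S \subset F) <-> (F = F1 \/ F = F2).

End Complex.

(* Main.v *)
(* Number the leaves in the order in which the contour of the tree meets them.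
   An arc is then a chord joining two leaves that, at every interior vertex,
   lie in equal or cyclically adjacent branches; two arcs cross exactly when
   their chords interleave, and boundary arcs are the sides of the polygon of
   leaves.  Consider sub-polygons [P] all of whose sides are arcs, and let
   [N P] be the number of interior vertices at which [P] meets at least three
   branches.  Cutting [P] along an arc distributes these vertices between the
   two halves, so [N] is additive; [N P >= 1] always, [N P >= 2] forces a
   diagonal that is an arc, and [N P = 2] allows exactly two of them.  Cutting
   along the members of a noncrossing family one after the other, facets have
   [N - 1] members and a family with [N - 2] members extends in exactly two
   ways. *)
Require Import Defs.
From mathcomp Require Import all_boot.
From mathcomp Require Import zify.

Set Implicit Arguments.
Unset Strict Implicit.
Unset Printing Implicit Defensive.

(** * Polygons and admissible chords *)

(** The polygon arguments use only a [branching]: a numbering of the leaves with a monotone turn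
    count at each node, which turns cyclic reasoning into linear arithmetic. Monotonicity gives
    additivity: at any node, one side of an admissible chord sees only the branches of the two ends.
    Diagonals arise as detours: if [v] and [w] are branch points of [P], the branch [Q] at [v]
    towards [w] contains two vertices of [P]. With [(s, t)] the side of [P] entering [Q] and
    [(t', s')] the one leaving it, both [(s, t')] and [(t, s')] are admissible. If there are only
    two branch points, any diagonal leaves one in each half, so each half has its vertices in
    distinct branches, which excludes a third diagonal. On the tree side, the obstacle is to get a
    cyclic order of leaves out of local rotations: walks along faces link each leaf to the next, and
    all leaves turn out to lie on one cycle. Crossing is defined through segments and regions;
    numbering each face by a leaf makes regions into intervals, so that incomparable regions mean
    interleaving ends. *)

Definition cyc (i j k : nat) := [|| i < j < k, j < k < i | k < i < j].
(** Each chord strictly separates the ends of the other; chords with a common end do not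
    interleave. *)
Definition interleave (i j k l : nat) :=
  cyc i k j && cyc j l i || cyc i l j && cyc j k i.

Lemma cyc_rot i j k : cyc i j k = cyc j k i.
Proof. by rewrite /cyc; lia. Qed.

Lemma cyc_flip n (i j k : 'I_n) :
  i != j -> j != k -> i != k -> ~~ cyc i j k -> cyc i k j.
Proof. by rewrite -!val_eqE /cyc /=; lia. Qed.

Lemma cyc_drop i j k l : cyc i j k -> cyc i k l -> cyc j k l.
Proof. by rewrite /cyc; lia. Qed.

Lemma cyc_trans i j k l : cyc i j k -> cyc i k l -> cyc i j l.
Proof. by rewrite /cyc; lia. Qed.

(* Branches at a vertex of degree [d] are indexed by a number of clockwise turns
   between [0] and [d]; [0] and [d] denote the same branch. *)
Definition gap (a b : nat) := (a - b) + (b - a).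
Definition eq_turn (d a b : nat) := (gap a b == 0) || (gap a b == d).
Definition near_turn (d a b : nat) :=
  [|| gap a b == 0, gap a b == 1, (gap a b).+1 == d | gap a b == d].

(** All that the polygon arguments know of the tree. In [branch_cut], the intended [Q] is the set of
    leaves in the branch at [v] that contains [w]: seen from [w], every other leaf lies beyond [v].
    [branch_median] is the median vertex of three leaves. *)
Record branching (n : nat) := Branching {
  node : finType;
  degree : node -> nat;
  turns : node -> 'I_n -> nat;
  degree_ge3 : forall v, 3 <= degree v;
  turns_homo : forall v (i j : 'I_n), i <= j -> turns v i <= turns v j;
  turns_le : forall v i, turns v i <= degree v;
  branch_cut : forall v w, v != w -> exists Q : {set 'I_n},
    [/\ forall i j, i \in Q -> j \in Q -> eq_turn (degree v) (turns v i) (turns v j),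
        forall i j, i \in Q -> eq_turn (degree v) (turns v i) (turns v j) -> j \in Q
      & forall i j, i \notin Q -> j \notin Q ->
          eq_turn (degree w) (turns w i) (turns w j)];
  branch_median : forall i j k, i != j -> j != k -> i != k -> exists v,
    [/\ ~~ eq_turn (degree v) (turns v i) (turns v j),
        ~~ eq_turn (degree v) (turns v j) (turns v k)
      & ~~ eq_turn (degree v) (turns v i) (turns v k)]
}.

Section Polygon.
Variables (n : nat) (B : branching n).
Implicit Types (v w : node B) (i j k l s t : 'I_n) (P Q : {set 'I_n}).

Definition same v i j := eq_turn (degree v) (turns v i) (turns v j).
Definition near v i j := near_turn (degree v) (turns v i) (turns v j).
Definition admissible i j := [forall v : node B, near v i j].

Lemma same_refl v i : same v i i. Proof. rewrite /same /eq_turn /gap; lia. Qed.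
Lemma same_sym v i j : same v i j = same v j i.
Proof. by rewrite /same /eq_turn /gap addnC. Qed.
Lemma same_trans v j i k : same v i j -> same v j k -> same v i k.
Proof.
have := turns_le v i; have := turns_le v j; have := turns_le v k; have := degree_ge3 v.
rewrite /same /eq_turn /gap; lia.
Qed.
Lemma near_sym v i j : near v i j = near v j i.
Proof. by rewrite /near /near_turn /gap addnC. Qed.
Lemma near_same v i j k : same v j k -> near v i j -> near v i k.
Proof.
have := turns_le v i; have := turns_le v j; have := turns_le v k; have := degree_ge3 v.
rewrite /same /near /eq_turn /near_turn /gap; lia.
Qed.

(** If the turn counts of the ends differ by at most one, monotonicity pins those of the leaves
    numbered between them. Otherwise they differ by [degree v - 1] or [degree v], and it pins those
    of all other leaves. *)
Lemma near_half v i j : i != j -> near v i j ->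
  (forall k, ~~ cyc j k i -> same v k i || same v k j) \/
  (forall k, ~~ cyc i k j -> same v k i || same v k j).
Proof.
wlog lt_ij : i j / i < j.
  move=> W ne_ij nij; case: (ltngtP i j) => [lt_ij|lt_ji|/val_inj eq_ij].
  - exact: W.
  - have [||H|H] := W j i lt_ji; rewrite 1?eq_sym 1?near_sym //.
    + by right=> k /H; rewrite orbC.
    + by left=> k /H; rewrite orbC.
  - by rewrite eq_ij eqxx in ne_ij.
move=> _ nij; have hij := @turns_homo _ B v i j (ltnW lt_ij).
have hj := turns_le v j; have d3 := degree_ge3 v.
have [small|big] := leqP (turns v j - turns v i) 1; [left|right] => k Ck.
  have /andP[/(@turns_homo _ B v) ? /(@turns_homo _ B v) ?] : (i <= k) && (k <= j).
    by move: Ck; rewrite /cyc; lia.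
  by move: nij; rewrite /same /near /eq_turn /near_turn /gap; lia.
have hk := turns_le v k.
have /orP[/(@turns_homo _ B v) ?|/(@turns_homo _ B v) ?] : (k <= i) || (j <= k).
    by move: Ck; rewrite /cyc; lia.
  by move: nij; rewrite /same /near /eq_turn /near_turn /gap; lia.
by move: nij; rewrite /same /near /eq_turn /near_turn /gap; lia.
Qed.

(** Equal counts are shared by all leaves in between; the counts [0] and [degree v] are shared by
    all leaves outside. *)
Lemma same_sorted v i j k l : i <= j -> j <= k -> k <= l ->
  (same v i k -> same v i j || same v i l) /\
  (same v j l -> same v j k || same v j i).
Proof.
move=> /(@turns_homo _ B v) + /(@turns_homo _ B v) + /(@turns_homo _ B v).
have := turns_le v l; have := degree_ge3 v.
rewrite /same /eq_turn /gap; lia.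
Qed.

Lemma same_interleave v i j k l : interleave i j k l ->
  same v i j -> same v i k || same v i l.
Proof.
move=> hI sij.
have core (a b c e : 'I_n) : a < b < c -> b < c < e ->
    (same v a c -> same v a b || same v a e) /\
    (same v b e -> same v b c || same v b a).
  by move=> *; apply: same_sorted; lia.
have sji : same v j i by rewrite same_sym.
have T : same v j k || same v j l -> same v i k || same v i l.
  by case/orP=> /(same_trans sij) -> //; rewrite orbT.
(* In each of the eight linear orders, [i] and [j] take the first and third places or the second and
   fourth, which are the two halves of [core]. *)
have : [\/ (i < k < j) && (k < j < l) || (i < l < j) && (l < j < k),
  (j < k < i) && (k < i < l) || (j < l < i) && (l < i < k),
  (k < i < l) && (i < l < j) || (k < j < l) && (j < l < i)
| (l < i < k) && (i < k < j) || (l < j < k) && (j < k < i)].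
  move: hI; rewrite /interleave /cyc => hI.
  suff: [|| (i < k < j) && (k < j < l), (i < l < j) && (l < j < k),
    (j < k < i) && (k < i < l), (j < l < i) && (l < i < k),
    (k < i < l) && (i < l < j), (k < j < l) && (j < l < i),
    (l < i < k) && (i < k < j) | (l < j < k) && (j < k < i)].
    do 7?case/orP; move=> ->; rewrite ?orbT;
      by [constructor 1|constructor 2|constructor 3|constructor 4].
  by move: hI; clear; lia.
case=> /orP[] /andP[a b]; have [H1 H2] := core _ _ _ _ a b.
- exact: H1.
- by rewrite orbC; exact: H1.
- by apply/T/H1.
- by apply: T; rewrite orbC; apply: H1.
- by rewrite orbC; apply: H2.
- by apply: T; rewrite orbC; apply: H2.
- exact: H2.
- by apply/T/H2.
Qed.

Definition successive P s t :=
  [&& s \in P, t \in P, s != t & [forall k in P, ~~ cyc s k t]].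

Definition polygon P :=
  2 < #|P| /\ forall s t, successive P s t -> admissible s t.

Definition diagonal P i j :=
  [&& i \in P, j \in P, [exists k in P, cyc i k j] & [exists k in P, cyc j k i]].

(** The half of [P] met on the way from [i] to [j], ends included; [slice P j i] is the other
    half. *)
Definition slice P i j := [set k in P | ~~ cyc j k i].

Definition branch_points P := [set v : node B |
  [exists i in P, exists j in P, exists k in P,
     [&& ~~ same v i j, ~~ same v j k & ~~ same v i k]]].

Lemma branch_pointsP P v : reflect
  (exists i j k, [/\ i \in P, j \in P & k \in P] /\
     [/\ ~~ same v i j, ~~ same v j k & ~~ same v i k])
  (v \in branch_points P).
Proof.
rewrite inE; apply: (iffP exists_inP) => [[i iP /exists_inP[j jP]]|].
  by case/exists_inP=> k kP /and3P[*]; exists i, j, k.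
case=> i [j [k [[iP jP kP] [nij njk nik]]]].
exists i => //; apply/exists_inP; exists j => //; apply/exists_inP.
by exists k => //; apply/and3P.
Qed.

Lemma admissible_sym i j : admissible i j = admissible j i.
Proof. by apply: eq_forallb => v; rewrite near_sym. Qed.

Lemma diagonal_sym P i j : diagonal P i j = diagonal P j i.
Proof. by rewrite /diagonal; do !case: (_ \in _) => //=; rewrite andbC. Qed.

Lemma diagonal_neq P i j : diagonal P i j -> i != j.
Proof.
case/and4P=> _ _ /exists_inP[k _ c] _; apply/eqP=> E.
by move: c; rewrite E /cyc; lia.
Qed.

Lemma slice_sub P i j : slice P i j \subset P.
Proof. by apply/subsetP=> k; rewrite inE => /andP[]. Qed.

(** A side of the slice other than [(j, i)] is a side of [P]: a vertex of [P] inside it would lie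
    strictly between [j] and [i], which forces the side to be [(j, i)]. *)
Lemma slice_polygon P i j :
  polygon P -> diagonal P i j -> admissible i j -> polygon (slice P i j).
Proof.
case=> _ sides /and4P[iP jP /exists_inP[k kP ckij] _] aij.
have iH : i \in slice P i j by rewrite inE iP /cyc; lia.
have jH : j \in slice P i j by rewrite inE jP /cyc; lia.
split.
  apply/card_gt2P; exists i, j, k; split; split=> //; last 3 first.
  - by apply/eqP=> E; move: ckij; rewrite E /cyc; lia.
  - by apply/eqP=> E; move: ckij; rewrite E /cyc; lia.
  - by apply/eqP=> E; move: ckij; rewrite E /cyc; lia.
  by rewrite inE kP; move: ckij; rewrite /cyc; lia.
move=> s t /and4P[sH tH nst /forall_inP gap_st].
have [/andP[/eqP-> /eqP->]|nji] := boolP ((s == j) && (t == i)).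
  by rewrite admissible_sym.
apply: sides; apply/and4P; split; rewrite ?(subsetP (slice_sub P i j)) //.
apply/forall_inP=> m mP; apply/negP=> csmt.
have cjmi : cyc j m i.
  by apply: contraTT csmt => c; apply: gap_st; rewrite inE mP.
move: (gap_st _ iH) (gap_st _ jH) nji csmt cjmi sH tH nst; rewrite !inE -!val_eqE /= /cyc.
case: (_ \in _); case: (_ \in _) => //=.
lia.
Qed.

(** At each node [near_half] names a half with all its vertices in the branches of [i] and [j]. The
    node is no branch point of that half, while the other half, which also contains [i] and [j],
    meets the same branches as [P]. *)
Lemma branch_points_slice P i j : diagonal P i j -> admissible i j ->
  branch_points P = branch_points (slice P i j) :|: branch_points (slice P j i)
  /\ [disjoint branch_points (slice P i j) & branch_points (slice P j i)].
Proof.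
move=> dij aij; have nij := diagonal_neq dij; case/and4P: dij => iP jP _ _.
have mono (H : {set 'I_n}) : H \subset P -> {subset branch_points H <= branch_points P}.
  move=> /subsetP sHP v /branch_pointsP[a [b [c [[aH bH cH] ne]]]].
  by apply/branch_pointsP; exists a, b, c; split; first by split; apply: sHP.
(* If the leaves outside [H'] lie in the branches of [i] and [j], then the
   other half meets at most two branches and [H'] as many as [P]. *)
have key v (H H' : {set 'I_n}) : i \in H' -> j \in H' ->
    (forall k, k \in H -> same v k i || same v k j) ->
    (forall k, k \in P -> k \notin H' -> k \in H) ->
    (v \notin branch_points H) /\
    (v \in branch_points P -> v \in branch_points H').
  move=> iH' jH' two cover; split.
    apply/negP=> /branch_pointsP[a [b [c [[/two A /two C /two D] []]]]].
    have T x y z : same v x z -> same v y z -> same v x y.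
      by rewrite (same_sym _ y) => *; apply: same_trans (_ : same v _ z) _.
    case/orP: A => A; case/orP: C => C; case/orP: D => D; rewrite ?(T _ _ _ A C) ?(T _ _ _ A D) ?(T _ _ _ C D) //.
  case/branch_pointsP=> a [b [c [[aP bP cP] [nab nbc nac]]]].
  have move_in k : k \in P -> exists2 k', k' \in H' & same v k k'.
    move=> kP; have [kH'|kH'] := boolP (k \in H').
      by exists k; rewrite ?same_refl.
    by case/orP: (two k (cover k kP kH')) => ?; [exists i|exists j].
  have [a' a'H sa] := move_in a aP; have [b' b'H sb] := move_in b bP.
  have [c' c'H sc] := move_in c cP.
  have T x y x' y' : same v x x' -> same v y y' -> ~~ same v x y -> ~~ same v x' y'.
    move=> sx sy; apply: contraNN => /(same_trans sx) /same_trans; apply.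
    by rewrite same_sym.
  apply/branch_pointsP; exists a', b', c'; split; first by split.
  by split; [apply: T nab|apply: T nbc|apply: T nac].
have iH : i \in slice P i j by rewrite inE iP /cyc; lia.
have jH : j \in slice P i j by rewrite inE jP /cyc; lia.
have iH' : i \in slice P j i by rewrite inE iP /cyc; lia.
have jH' : j \in slice P j i by rewrite inE jP /cyc; lia.
have side v : (v \notin branch_points (slice P i j)) /\
    (v \in branch_points P -> v \in branch_points (slice P j i)) \/
    (v \notin branch_points (slice P j i)) /\
    (v \in branch_points P -> v \in branch_points (slice P i j)).
  case: (near_half nij (forallP aij v)) => two; [left|right]; apply: key => //.
  - by move=> k; rewrite inE => /andP[_ /two].
  - by move=> k; rewrite !inE => -> /=; rewrite negbK /cyc; lia.
  - by move=> k; rewrite inE => /andP[_ /two].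
  - by move=> k; rewrite !inE => -> /=; rewrite negbK /cyc; lia.
split.
  apply/setP=> v; rewrite in_setU; apply/idP/orP.
    by case: (side v) => -[_ W] /W; [right|left].
  by case; apply: mono; apply: slice_sub.
apply/pred0P=> v /=; apply/negP=> /andP[v1 v2].
by case: (side v) => -[]; rewrite ?v1 ?v2.
Qed.

Lemma branch_points_gt0 P : polygon P -> 0 < #|branch_points P|.
Proof.
case=> /card_gt2P[i [j [k [[iP jP kP] [nij njk nki]]]]] _.
have [|v [sij sjk sik]] := @branch_median n B i j k nij njk; first by rewrite eq_sym.
by apply/card_gt0P; exists v; apply/branch_pointsP; exists i, j, k.
Qed.

(** A vertex of [P] strictly between [i] and [j] replaces one of them, according to whether it lies
    in [Q]; the cyclic distance [dist] drops until the pair is a side. *)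
Lemma exists_entry P Q i j : i \in P -> i \notin Q -> j \in P -> j \in Q ->
  exists s t, [/\ successive P s t, s \notin Q & t \in Q].
Proof.
pose dist (s t : 'I_n) := if s <= t then t - s else t + n - s.
have [m] := ubnP (dist i j); elim: m i j => // m IH i j lt_m iP iQ jP jQ.
have nij : i != j by apply: contraNneq iQ => ->.
have [|] := boolP (successive P i j); first by exists i, j.
rewrite /successive iP jP nij /= => /forall_inPn[k kP]; rewrite negbK => cikj.
have := ltn_ord i; have := ltn_ord j; have := ltn_ord k => ? ? ?.
have [kQ|kQ] := boolP (k \in Q).
  by apply: (IH i k) => //; move: cikj lt_m; rewrite /dist /cyc; do !case: ifP; lia.
by apply: (IH k j) => //; move: cikj lt_m; rewrite /dist /cyc; do !case: ifP; lia.
Qed.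

(* The sides [(s, t)] and [(t', s')] enter and leave a branch at [v]; any other
   vertex sees [s, s'] or [t, t'] in a single branch. *)
Lemma admissible_bypass v (s t t' s' : 'I_n) :
  same v t t' -> ~~ same v s t -> ~~ same v s' t ->
  admissible s t -> admissible t' s' -> admissible s t'.
Proof.
move=> stt' nst ns't ast at's'; apply/forallP=> w.
have [->|nvw] := eqVneq w v; first by apply: near_same stt' (forallP ast v).
have /branch_cut[Q [Qv Qcl nQ]] : v != w by rewrite eq_sym.
have [tQ|tQ] := boolP (t \in Q).
  have sQ : s \notin Q by apply: contra nst => sQ; apply: Qv.
  have s'Q : s' \notin Q by apply: contra ns't => s'Q; apply: Qv.
  rewrite near_sym; apply: near_same (nQ _ _ s'Q sQ) _.
  exact: (forallP at's').
have t'Q : t' \notin Q by apply: contra tQ => ?; apply: Qcl (_ : t' \in Q) _ => //; rewrite -/(same v t' t) same_sym.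
exact: near_same (nQ _ _ tQ t'Q) (forallP ast w).
Qed.

Ltac neq H :=
  solve [exact: H | rewrite eq_sym; exact: H | done | by rewrite eq_sym].

(** Two vertices of [P] lie in the branch [Q] and two outside. As the leaves of a branch form a
    cyclic interval, an entering side and a leaving side then share no end, so each bypass has
    vertices of [P] on both sides. *)
Lemma exists_bypass P v (Q : {set 'I_n}) a b : polygon P -> v \in branch_points P ->
  (forall i j, i \in Q -> j \in Q -> same v i j) ->
  (forall i j, i \in Q -> same v i j -> j \in Q) ->
  a \in P -> b \in P -> a \in Q -> b \in Q -> a != b ->
  exists s t t' s',
   [/\ successive P s t, successive P t' s',
       [/\ s \notin Q, t \in Q, t' \in Q & s' \notin Q],
       diagonal P s t' /\ admissible s t' &
       diagonal P t s' /\ admissible t s'].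
Proof.
move=> polyP vP Qv Qcl aP bP aQ bQ nab.
have [c [e [[cP eP] [cQ eQ] nce]]] : exists c e,
    [/\ c \in P /\ e \in P, c \notin Q /\ e \notin Q & c != e].
  have ne x y : ~~ same v x y -> x != y.
    by apply: contraNneq => ->; rewrite same_refl.
  have one x y : ~~ same v x y -> x \in Q -> y \notin Q.
    by move=> nxy xQ; apply: contra nxy; apply: Qv.
  case/branch_pointsP: vP => x [y [z [[xP yP zP] [nxy nyz nxz]]]].
  have [xQ|xQ] := boolP (x \in Q).
    by exists y, z; split; [split|split; apply: one xQ|apply: ne].
  have [yQ|yQ] := boolP (y \in Q).
    by exists x, z; split; [split|split=> //; apply: one yQ|apply: ne].
  by exists x, y; split=> //; apply: ne.
have [s [t [st sQ tQ]]] := exists_entry cP cQ aP aQ.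
have [||t' [s' [ts t'Q s'Q]]] := @exists_entry P (~: Q) a c aP _ cP.
- by rewrite inE negbK.
- by rewrite inE.
rewrite !inE negbK in t'Q s'Q.
have /and4P[sP tP _ /forall_inP Hst] := st.
have /and4P[t'P s'P _ /forall_inP Hts] := ts.
have neQ x y : x \in Q -> y \notin Q -> x != y.
  by move=> xQ; apply: contraNneq => <-.
have nots x y : x \in Q -> y \notin Q -> same v x y = false.
  by move=> xQ yQ; apply: contraNF yQ; apply: Qcl.
have nots' x y : x \notin Q -> y \in Q -> ~~ same v x y.
  by move=> xQ yQ; rewrite same_sym nots.
(* Otherwise any other vertex [y] of [P] in [Q] would form with [t] a chord separating [s'] from
   [s]. *)
have ntt' : t != t'.
  apply/eqP=> E; subst t'.
  have [y [yP yQ nyt]] : exists y, [/\ y \in P, y \in Q & y != t].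
    have [E|] := eqVneq a t; last by exists a.
    by exists b; split; rewrite // -E eq_sym.
  have : interleave t y s' s.
    apply/orP; left; apply/andP; split.
      by apply: cyc_flip; [neq neQ..|exact: (Hts y)].
    by rewrite cyc_rot; apply: cyc_flip; [neq neQ..|exact: (Hst y)].
  by move/same_interleave/(_ (Qv _ _ tQ yQ)); rewrite !nots.
(* Otherwise any other vertex [y] of [P] outside [Q] would lie between [t] and [t'], with [s] on the
   other side of that chord. *)
have nss' : s != s'.
  apply/eqP=> E; subst s'.
  have [y [yP yQ nyt]] : exists y, [/\ y \in P, y \notin Q & y != s].
    have [E|] := eqVneq c s; last by exists c.
    by exists e; split; rewrite // -E eq_sym.
  have stt' : cyc s t t' by apply: cyc_flip; [neq neQ..|exact: (Hst t')].
  have sty : cyc s t y by apply: cyc_flip; [neq neQ..|exact: (Hst y)].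
  have syt' : cyc s y t' by rewrite -cyc_rot; apply: cyc_flip; [neq neQ..|exact: (Hts y)].
  have : interleave t t' y s.
    by apply/orP; left; rewrite (cyc_drop sty syt') /= cyc_rot stt'.
  by move/same_interleave/(_ (Qv _ _ tQ t'Q)); rewrite !nots.
have sides := proj2 polyP.
exists s, t, t', s'; split=> //; (split; last first).
- by apply: (@admissible_bypass v s t t' s'); rewrite ?nots' ?Qv //; apply: sides.
- apply/and4P; split=> //; apply/exists_inP; [exists t|exists s'] => //.
    by apply: cyc_flip; [neq neQ..|exact: (Hst t')].
  by apply: cyc_flip; [neq neQ..|exact: (Hts s)].
- rewrite admissible_sym.
  apply: (@admissible_bypass v s' t' t s); rewrite ?nots' ?Qv //;
  by rewrite admissible_sym; apply: sides.
- apply/and4P; split=> //; apply/exists_inP; [exists t'|exists s] => //.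
    by rewrite cyc_rot; apply: cyc_flip; [neq neQ..|exact: (Hts t)].
  by rewrite cyc_rot; apply: cyc_flip; [neq neQ..|exact: (Hst s')].
Qed.

Lemma card_branch_points_slice P i j :
  polygon P -> diagonal P i j -> admissible i j ->
  [/\ polygon (slice P i j), polygon (slice P j i) &
    #|branch_points P| =
      #|branch_points (slice P i j)| + #|branch_points (slice P j i)|].
Proof.
move=> polyP dij aij; split; first exact: slice_polygon.
  by apply: slice_polygon; rewrite 1?diagonal_sym 1?admissible_sym.
have [-> /disjoint_setI0 E] := branch_points_slice dij aij.
by rewrite cardsU E cards0 subn0.
Qed.

Lemma exists_diagonal_class P v a b : polygon P -> v \in branch_points P ->
  a \in P -> b \in P -> a != b -> same v a b ->
  exists i j, diagonal P i j /\ admissible i j.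
Proof.
move=> polyP vP aP bP nab sab.
have QQ i j : i \in [set k | same v a k] -> j \in [set k | same v a k] -> same v i j.
  by rewrite !inE [same v a i]same_sym; apply: same_trans.
have Qcl i j : i \in [set k | same v a k] -> same v i j -> j \in [set k | same v a k].
  by rewrite !inE; apply: same_trans.
have [||s [t [t' [s' [_ _ _ D _]]]]] := exists_bypass polyP vP QQ Qcl aP bP _ _ nab.
- by rewrite inE same_refl.
- by rewrite inE.
by exists s, t'.
Qed.

(** Of three vertices in distinct branches at [v], at most one lies outside [Q]. It is applied with
    [Q] the branch at another node towards [v]. *)
Lemma class_pair P v (Q : {set 'I_n}) : v \in branch_points P ->
  (forall i j, i \notin Q -> j \notin Q -> same v i j) ->
  exists a b, [/\ a \in P, b \in P, a \in Q, b \in Q & a != b].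
Proof.
move=> /branch_pointsP[x [y [z [[xP yP zP] [nxy nyz nxz]]]]] Qv.
have ne i j : ~~ same v i j -> i != j.
  by apply: contraNneq => ->; rewrite same_refl.
have one i j : ~~ same v i j -> i \notin Q -> j \in Q.
  by move=> nij iQ; apply: contraNT nij; apply: Qv.
have [xQ|xQ] := boolP (x \in Q); last first.
  by exists y, z; split=> //; [exact: one nxy xQ|exact: one nxz xQ|exact: ne].
have [yQ|yQ] := boolP (y \in Q); first by exists x, y; split=> //; exact: ne.
by exists x, z; split=> //; [exact: one nyz yQ|exact: ne].
Qed.

Lemma exists_diagonal P : polygon P -> 1 < #|branch_points P| ->
  exists i j, diagonal P i j /\ admissible i j.
Proof.
move=> polyP /card_gt1P[v [w [vP wP nvw]]].
have [Q [Qv _ Qw]] := branch_cut nvw.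
have [a [b [aP bP aQ bQ nab]]] := class_pair wP Qw.
exact: exists_diagonal_class vP aP bP nab (Qv _ _ aQ bQ).
Qed.

(** Two vertices in one branch would give an admissible diagonal, and each half would have a branch
    point of its own. *)
Lemma same_branch_inj P v a b : polygon P -> #|branch_points P| = 1 ->
  v \in branch_points P -> a \in P -> b \in P -> same v a b -> a = b.
Proof.
move=> polyP one vP aP bP sab; apply/eqP; apply: wlog_neg => nab.
have [i [j [dij aij]]] := exists_diagonal_class polyP vP aP bP nab sab.
have [p1 p2] := card_branch_points_slice polyP dij aij.
have := branch_points_gt0 p1; have := branch_points_gt0 p2; lia.
Qed.

Definition same_ends i j k l :=
  (i == k) && (j == l) || (i == l) && (j == k).

Lemma two_diagonals P : polygon P -> #|branch_points P| = 2 ->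
  exists i1 j1 i2 j2,
    [/\ diagonal P i1 j1 /\ admissible i1 j1,
        diagonal P i2 j2 /\ admissible i2 j2,
        ~~ same_ends i1 j1 i2 j2 &
        forall i j, diagonal P i j -> admissible i j ->
          same_ends i j i1 j1 || same_ends i j i2 j2].
Proof.
move=> polyP two.
have /card_gt1P[v [w [vP wP nvw]]] : 1 < #|branch_points P| by rewrite two.
have [Q [Qv Qcl Qw]] := branch_cut nvw.
have [a [b [aP bP aQ bQ nab]]] := class_pair wP Qw.
have [s [t [t' [s' [st ts [sQ tQ t'Q s'Q] D1 D2]]]]] :=
  exists_bypass polyP vP Qv Qcl aP bP aQ bQ nab.
have /and4P[sP tP _ /forall_inP Hst] := st.
have /and4P[t'P s'P _ /forall_inP Hts] := ts.
have neQ x y : x \in Q -> y \notin Q -> (x == y) = false.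
  by move=> xQ yQ; apply: contraNF yQ => /eqP <-.
exists s, t', t, s'; split=> //.
  rewrite /same_ends [s == t]eq_sym neQ //=; apply/negP=> /andP[_ /eqP E].
  case: D1 => /and4P[_ _ /exists_inP[k kP]]; rewrite E => C _ _.
  by have := Hst k kP; rewrite C.
(* Exchanging [i] and [j] if necessary, [v] is the branch point of [slice P j i], and [w] then that
   of [slice P i j]. *)
suff main i j : diagonal P i j -> admissible i j ->
    v \in branch_points (slice P j i) ->
    same_ends i j s t' || same_ends i j t s'.
  move=> i j dij aij.
  have [E _] := branch_points_slice dij aij.
  have := vP; rewrite E in_setU => /orP[] vH; last exact: main vH.
  have := main j i; rewrite diagonal_sym admissible_sym => /(_ dij aij vH).
  by rewrite /same_ends; case/orP=> /orP[] /andP[-> ->]; rewrite ?orbT.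
move=> dij aij v2; have nij := diagonal_neq dij.
have [p1 p2 N] := card_branch_points_slice polyP dij aij.
have [E disj] := branch_points_slice dij aij.
have [N1 N2] : #|branch_points (slice P i j)| = 1 /\
               #|branch_points (slice P j i)| = 1.
  by move: (branch_points_gt0 p1) (branch_points_gt0 p2) N; rewrite two; clear; lia.
have w1 : w \in branch_points (slice P i j).
  have := wP; rewrite E in_setU => /orP[w1|w2]; first exact: w1.
  move/eqP/cards1P: N2 => [x Ex].
  by move: v2 w2 nvw; rewrite Ex !in_set1 => /eqP-> /eqP->; rewrite eqxx.
(* All vertices outside [Q] lie in one branch at [w], so [slice P i j] has at most one of them; all
   those in [Q] lie in one branch at [v], so [slice P j i] has at most one of those. *)
have in1 x y : x \in P -> ~~ cyc j x i -> y \in P -> ~~ cyc j y i ->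
    x \notin Q -> y \notin Q -> x = y.
  move=> xP Cx yP Cy xQ yQ; apply: (same_branch_inj p1 N1 w1); rewrite ?inE ?xP ?yP //.
  exact: Qw.
have in2 x y : x \in P -> ~~ cyc i x j -> y \in P -> ~~ cyc i y j ->
    x \in Q -> y \in Q -> x = y.
  move=> xP Cx yP Cy xQ yQ; apply: (same_branch_inj p2 N2 v2); rewrite ?inE ?xP ?yP //.
  exact: Qv.
have /and4P[iP jP _ _] := dij.
have cycF x y : cyc x x y = false /\ cyc x y y = false by rewrite /cyc; clear; lia.
have [c1 c2 c3 c4] : [/\ cyc i i j = false, cyc i j j = false, cyc j i i = false & cyc j j i = false].
  by case: (cycF i j) (cycF j i) => -> -> [-> ->].
(* Exactly one of [i], [j] is in [Q]. The other vertices in [Q] lie strictly between [i] and [j],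
   and the other ones outside [Q] strictly between [j] and [i]. So both sides crossing the border of
   [Q] have an end on the diagonal. *)
have [iQ|iQ] := boolP (i \in Q); have [jQ|jQ] := boolP (j \in Q).
- by case/eqP: nij; apply: in2; rewrite ?c1 ?c2.
- have Ht x : x \in P -> x \in Q -> x != i -> cyc i x j.
    by move=> xP xQ; apply: contraNT => C; apply/eqP/(in2 _ _ xP C iP (negbT c1) xQ iQ).
  have Hs x : x \in P -> x \notin Q -> x != j -> cyc j x i.
    by move=> xP xQ; apply: contraNT => C; apply/eqP/(in1 _ _ xP C jP (negbT c4) xQ jQ).
  suff [/eqP ti /eqP sj] : t == i /\ s' == j by rewrite /same_ends ti sj !eqxx !orbT.
  split; apply: wlog_neg => ne.
    case/negP: (Hst i iP); have C := Ht t tP tQ ne.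
    have [->|/(Hs s sP sQ) C'] := eqVneq s j; first by rewrite cyc_rot.
    by rewrite cyc_rot; apply: cyc_trans C _; rewrite cyc_rot.
  case/negP: (Hts j jP); have C := Hs s' s'P s'Q ne.
  have [->|/(Ht t' t'P t'Q) C'] := eqVneq t' i; first by rewrite cyc_rot.
  by apply: cyc_drop C' _; rewrite cyc_rot.
- have Ht x : x \in P -> x \in Q -> x != j -> cyc i x j.
    by move=> xP xQ; apply: contraNT => C; apply/eqP/(in2 _ _ xP C jP (negbT c2) xQ jQ).
  have Hs x : x \in P -> x \notin Q -> x != i -> cyc j x i.
    by move=> xP xQ; apply: contraNT => C; apply/eqP/(in1 _ _ xP C iP (negbT c3) xQ iQ).
  suff [/eqP ti /eqP sj] : t' == j /\ s == i by rewrite /same_ends ti sj !eqxx.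
  split; apply: wlog_neg => ne.
    case/negP: (Hts j jP); have C := Ht t' t'P t'Q ne.
    have [->|/(Hs s' s'P s'Q) C'] := eqVneq s' i; first by rewrite -cyc_rot.
    by apply: cyc_drop C _; rewrite cyc_rot.
  case/negP: (Hst i iP); have C := Hs s sP sQ ne.
  have [->|/(Ht t tP tQ) C'] := eqVneq t j; first by rewrite -cyc_rot.
  by rewrite cyc_rot; apply: cyc_trans C' _; rewrite cyc_rot.
- by case/eqP: nij; apply: in1; rewrite ?c3 ?c4.
Qed.

End Polygon.

(** * Noncrossing families of chords *)

Lemma interleave_sym i j k l : interleave i j k l = interleave k l i j.
Proof.
suff W i' j' k' l' : interleave i' j' k' l' -> interleave k' l' i' j'.
  by apply/idP/idP; apply: W.
by rewrite /interleave /cyc; lia.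
Qed.

Lemma interleave_slices (i j k l m p : nat) : i != j ->
  ~~ cyc j k i -> ~~ cyc j l i -> ~~ cyc i m j -> ~~ cyc i p j ->
  ~~ interleave k l m p.
Proof.
wlog lt_ij : i j k l m p / i <= j.
  move=> W; have [le_ij|/ltnW le_ji] := leqP i j; first exact: W.
  move=> nij Ck Cl Cm Cp.
  rewrite interleave_sym.
  by apply: W le_ji _ _ _ _ _; rewrite // eq_sym.
rewrite /interleave /cyc; lia.
Qed.

(** Trades a vertex cut off by the chord [(i, j)] for [i] or [j], which stay in the slice. *)
Lemma cyc_shortcut (i j k l m : nat) : ~~ cyc j k i -> ~~ cyc j l i ->
  ~~ ((k == i) && (l == j) || (k == j) && (l == i)) ->
  cyc j m i -> cyc k m l -> cyc k i l || cyc k j l.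
Proof. rewrite /cyc; lia. Qed.

Section Chords.
Variables (n : nat) (B : branching n).
(** [A] stands for the inner arcs; through [e1] and [e2] it is in bijection with the admissible
    diagonals of the full polygon, as unordered pairs. *)
Variables (X : finType) (A : {set X}) (e1 e2 : X -> 'I_n).
Hypothesis A_admissible : forall x, x \in A -> admissible B (e1 x) (e2 x).
Hypothesis A_inj : forall x y, x \in A -> y \in A ->
  same_ends (e1 x) (e2 x) (e1 y) (e2 y) -> x = y.
Hypothesis A_surj : forall i j, diagonal setT i j -> admissible B i j ->
  exists2 x, x \in A & same_ends i j (e1 x) (e2 x).
Hypothesis A_diagonal : forall x, x \in A -> diagonal setT (e1 x) (e2 x).

Implicit Types (x y z : X) (i j k l : 'I_n) (P : {set 'I_n}) (S F : {set X}).

Definition chords P := [set x in A | diagonal P (e1 x) (e2 x)].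
Definition crosses x y := interleave (e1 x) (e2 x) (e1 y) (e2 y).
Definition dissection S := S \subset A /\ {in S &, forall x y, ~~ crosses x y}.

Lemma crosses_sym x y : crosses x y = crosses y x.
Proof. exact: interleave_sym. Qed.

Lemma crossesxx x : ~~ crosses x x.
Proof. by rewrite /crosses /interleave /cyc; lia. Qed.

Lemma diagonal_subset P P' i j : P \subset P' -> diagonal P i j -> diagonal P' i j.
Proof.
move=> /subsetP sP /and4P[iP jP /exists_inP[k kP Ck] /exists_inP[l lP Cl]].
apply/and4P; split; try exact: sP; apply/exists_inP; [exists k|exists l] => //; exact: sP.
Qed.

Lemma diagonal_slice P i j k l : i \in P -> j \in P ->
  k \in slice P i j -> l \in slice P i j -> diagonal P k l ->
  ~~ same_ends k l i j -> diagonal (slice P i j) k l.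
Proof.
move=> iP jP kS lS /and4P[_ _ /exists_inP[m mP Cm] /exists_inP[p pP Cp]] ne.
have iS : i \in slice P i j by rewrite inE iP /cyc; clear; lia.
have jS : j \in slice P i j by rewrite inE jP /cyc; clear; lia.
have [Ck Cl] : ~~ cyc j k i /\ ~~ cyc j l i.
  by move: kS lS; rewrite !inE => /andP[_ ?] /andP[_ ?].
have find k' l' m' : ~~ cyc j k' i -> ~~ cyc j l' i -> ~~ same_ends k' l' i j ->
    m' \in P -> cyc k' m' l' -> [exists q in slice P i j, cyc k' q l'].
  move=> C1 C2 ne' m'P C'; have [C3|C3] := boolP (cyc j m' i).
    have /orP[] := cyc_shortcut C1 C2 ne' C3 C' => C4.
      by apply/exists_inP; exists i.
    by apply/exists_inP; exists j.
  by apply/exists_inP; exists m' => //; rewrite inE m'P.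
apply/and4P; split=> //; first exact: find Cm.
apply: find Cp => //; apply: contraNN ne; rewrite /same_ends.
by case/orP=> /andP[-> ->]; rewrite ?orbT.
Qed.

Lemma chords_sliceE P x y : x \in chords P -> y \in chords P -> y != x ->
  ~~ crosses x y ->
  (y \in chords (slice P (e1 x) (e2 x))) || (y \in chords (slice P (e2 x) (e1 x))).
Proof.
rewrite !inE => /andP[xA dx] /andP[yA dy] nyx ncr.
have /and4P[iP jP _ _] := dx; have /and4P[kP lP _ _] := dy.
have ne : ~~ same_ends (e1 y) (e2 y) (e1 x) (e2 x).
  by apply: contraNN nyx => /A_inj ->.
have ne' : ~~ same_ends (e1 y) (e2 y) (e2 x) (e1 x).
  by apply: contraNN ne; rewrite /same_ends orbC.
rewrite yA /=.
have asym i j k : cyc i k j -> ~~ cyc j k i by rewrite /cyc; clear; lia.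
have [/andP[C1 C2]|C] :=
    boolP (~~ cyc (e2 x) (e1 y) (e1 x) && ~~ cyc (e2 x) (e2 y) (e1 x)).
  by rewrite diagonal_slice // inE ?kP ?lP.
suff /andP[C1 C2] : ~~ cyc (e1 x) (e1 y) (e2 x) && ~~ cyc (e1 x) (e2 y) (e2 x).
  by rewrite orbC diagonal_slice // inE ?kP ?lP.
move: C ncr (asym (e1 x) (e2 x) (e1 y)) (asym (e1 x) (e2 x) (e2 y)).
rewrite /crosses /interleave.
do 4!case: (cyc _ _ _); rewrite //= => _ _ H1 H2; by [move: (H1 isT)|move: (H2 isT)].
Qed.

Lemma chords_sliceP P x y : x \in chords P ->
  y \in chords (slice P (e1 x) (e2 x)) ->
  [/\ y \in chords P, y != x & ~~ crosses x y].
Proof.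
rewrite !inE => /andP[xA dx] /andP[yA dy]; rewrite yA; split.
- by apply: diagonal_subset dy; apply: slice_sub.
- apply/eqP=> E; case/and4P: dy => _ _ _ /exists_inP[m].
  by rewrite E inE => /andP[_ /negbTE->].
case/and4P: dy; rewrite !inE => /andP[_ C1] /andP[_ C2] _ _.
by rewrite /crosses /interleave (negbTE C1) (negbTE C2) !andbF.
Qed.

Lemma chords_sliceP' P x y : x \in chords P ->
  y \in chords (slice P (e2 x) (e1 x)) ->
  [/\ y \in chords P, y != x & ~~ crosses x y].
Proof.
rewrite !inE => /andP[xA dx] /andP[yA dy]; rewrite yA; split.
- by apply: diagonal_subset dy; apply: slice_sub.
- apply/eqP=> E; case/and4P: dy => _ _ /exists_inP[m].
  by rewrite E inE => /andP[_ /negbTE->].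
case/and4P: dy; rewrite !inE => /andP[_ C1] /andP[_ C2] _ _.
by rewrite /crosses /interleave (negbTE C1) (negbTE C2).
Qed.

Lemma crosses_slices P x y z : x \in chords P ->
  y \in chords (slice P (e1 x) (e2 x)) -> z \in chords (slice P (e2 x) (e1 x)) ->
  ~~ crosses y z.
Proof.
rewrite !inE => /andP[_ dx] /andP[_ /and4P[]] + + _ _ /andP[_ /and4P[]] + + _ _.
rewrite !inE => /andP[_ C1] /andP[_ C2] /andP[_ C3] /andP[_ C4].
exact: interleave_slices (diagonal_neq dx) C1 C2 C3 C4.
Qed.

Definition compatible P S y :=
  [&& y \in chords P, y \notin S & [forall z in S, ~~ crosses y z]].

Definition pairwise_noncrossing S := {in S &, forall x y, ~~ crosses x y}.

(** The induction step of the counts below. A chord of [P] that does not cross [x] belongs to one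
    half, and chords of different halves never cross, so both [S] and its possible extensions
    split. *)
Lemma noncrossing_glue P S x :
  polygon B P -> S \subset chords P -> pairwise_noncrossing S -> x \in S ->
  let P1 := slice P (e1 x) (e2 x) in let P2 := slice P (e2 x) (e1 x) in
  let S1 := S :&: chords P1 in let S2 := S :&: chords P2 in
  [/\ polygon B P1, polygon B P2,
      #|branch_points B P| = #|branch_points B P1| + #|branch_points B P2|,
      #|S| = (#|S1| + #|S2|).+1
    & forall y, compatible P S y = compatible P1 S1 y || compatible P2 S2 y].
Proof.
move=> polyP /subsetP sSP ncS xS P1 P2 S1 S2.
have xP := sSP x xS; have := xP; rewrite inE => /andP[xA dx].
have [p1 p2 N] := card_branch_points_slice polyP dx (A_admissible xA).
have split_S y : (y \in S) = [|| y == x, y \in S1 | y \in S2].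
  rewrite !inE; have [->|nyx] := eqVneq y x; first by rewrite xS.
  have [yS|//] := boolP (y \in S); rewrite !andTb.
  by have := chords_sliceE xP (sSP y yS) nyx (ncS x y xS yS); rewrite !inE.
(* A chord of both halves would have the ends of [x], hence be [x] itself. *)
have disj y : y \in chords P1 -> y \in chords P2 -> False.
  move=> y1 y2; have [yP nyx _] := chords_sliceP xP y1.
  have /and4P[_ _ _ /exists_inP[k]] : diagonal P1 (e1 y) (e2 y).
    by move: y1; rewrite inE => /andP[].
  move: y1 y2; rewrite !inE => /andP[yA d1] /andP[_ d2].
  have ny := diagonal_neq d1.
  case/negP: nyx; apply/eqP/A_inj => //.
  case/and4P: d1; case/and4P: d2; rewrite /P1 /P2 !inE.
  move=> /andP[_ c1] /andP[_ c2] _ _ /andP[_ c3] /andP[_ c4] _ _.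
  move: c1 c2 c3 c4 (diagonal_neq dx) ny; clear.
  by rewrite /same_ends -!val_eqE /cyc /=; lia.
split=> //.
  have E : S = x |: (S1 :|: S2) by apply/setP=> y; rewrite split_S !inE.
  have xN : x \notin S1 :|: S2.
    rewrite !inE xS; apply/negP=> /orP[] /=.
      by move=> x1; case: (chords_sliceP xP (_ : x \in chords P1)); rewrite ?inE ?eqxx.
    by move=> x1; case: (chords_sliceP' xP (_ : x \in chords P2)); rewrite ?inE ?eqxx.
  have D : S1 :&: S2 = set0.
    apply/eqP; rewrite -subset0; apply/subsetP=> y; rewrite in_setI.
    by case/andP=> /setIP[_ y1] /setIP[_ y2]; case: (disj y).
  by rewrite {1}E cardsU1 xN cardsU D cards0 subn0.
move=> y; apply/idP/idP.
  case/and3P=> yP yS /forall_inP ncy.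
  have nyx : y != x by apply: contraNneq yS => ->.
  have ncxy : ~~ crosses x y by rewrite crosses_sym ncy.
  case/orP: (chords_sliceE xP yP nyx ncxy) => yi; apply/orP; [left|right];
    apply/and3P; split; rewrite ?in_setI ?(negbTE yS) //;
    by apply/forall_inP=> z /setIP[zS _]; apply: ncy.
case/orP=> /and3P[yi yS /forall_inP ncy].
  have [yP nyx ncxy] := chords_sliceP xP yi.
  apply/and3P; split=> //; first by apply: contra yS => yS; rewrite in_setI yS.
  apply/forall_inP=> z; rewrite split_S => /or3P[/eqP->|/ncy //|/setIP[_ z2]].
    by rewrite crosses_sym.
  exact: crosses_slices xP yi z2.
have [yP nyx ncxy] := chords_sliceP' xP yi.
apply/and3P; split=> //; first by apply: contra yS => yS; rewrite in_setI yS.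
apply/forall_inP=> z; rewrite split_S => /or3P[/eqP->|/setIP[_ z1]|/ncy //].
  by rewrite crosses_sym.
by rewrite crosses_sym; apply: crosses_slices xP z1 yi.
Qed.

Lemma subset_diagonal P i j : diagonal P i j -> diagonal setT i j.
Proof. exact: diagonal_subset (subsetT P). Qed.

Lemma noncrossingS S S' :
  S' \subset S -> pairwise_noncrossing S -> pairwise_noncrossing S'.
Proof. by move=> /subsetP sS nc x y /sS xS /sS; apply: nc. Qed.

Lemma exists_chord P i j : diagonal P i j -> admissible B i j ->
  exists2 x, x \in chords P & same_ends i j (e1 x) (e2 x).
Proof.
move=> dij aij; have [x xA E] := A_surj (subset_diagonal dij) aij.
exists x => //; rewrite inE xA /=.
by case/orP: E dij => /andP[/eqP-> /eqP->] //; rewrite diagonal_sym.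
Qed.

(** Cutting along a member of [S] gives [#|S| = c1 + c2 + 1], while branch points add up. So the
    strict bounds in the halves yield the strict bound in [P], and room for a chord in [P] means
    room in one half. *)
Lemma noncrossing_extend P S :
  polygon B P -> S \subset chords P -> pairwise_noncrossing S ->
  #|S| < #|branch_points B P| /\
  (#|S|.+1 < #|branch_points B P| -> exists y, compatible P S y).
Proof.
have [m] := ubnP #|S|; elim: m P S => // m IH P S lt_m polyP sSP ncS.
have [S0|[x xS]] := set_0Vmem S.
  rewrite S0 cards0; split=> [|lt1]; first exact: branch_points_gt0.
  have [i [j [dij aij]]] := exists_diagonal polyP lt1.
  have [y yP _] := exists_chord dij aij.
  by exists y; rewrite /compatible yP inE; apply/forall_inP=> z; rewrite inE.
have [p1 p2 -> cS ext] := noncrossing_glue polyP sSP ncS xS.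
have [|H1 E1] := IH _ _ _ p1 (subsetIr _ _) (noncrossingS (subsetIl _ _) ncS).
  by move: lt_m; rewrite cS; clear; lia.
have [|H2 E2] := IH _ _ _ p2 (subsetIr _ _) (noncrossingS (subsetIl _ _) ncS).
  by move: lt_m; rewrite cS; clear; lia.
rewrite cS; split; first by move: H1 H2; clear; lia.
move: E1 E2; set c1 := #|S :&: _|; set c2 := #|S :&: _|.
set N1 := #|branch_points B _|; set N2 := #|branch_points B _| => E1 E2 lt.
have [lt1|le1] := ltnP c1.+1 N1.
  by have [y y1] := E1 lt1; exists y; rewrite ext y1.
have [|y y2] := E2; first by move: lt le1; clear; lia.
by exists y; rewrite ext y2 orbT.
Qed.

Lemma noncrossing_full P S :
  polygon B P -> S \subset chords P -> pairwise_noncrossing S ->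
  #|S|.+1 = #|branch_points B P| -> forall y, compatible P S y = false.
Proof.
move=> polyP sSP ncS full y; apply/negP=> /and3P[yP yS /forall_inP ncy].
have [] := @noncrossing_extend P (y |: S) polyP.
- by rewrite subUset sub1set yP.
- move=> a b /setU1P[->|aS] /setU1P[->|bS].
  + exact: crossesxx.
  + exact: ncy.
  + by rewrite crosses_sym ncy.
  + exact: ncS.
by rewrite cardsU1 yS add1n full ltnn.
Qed.

(** After a cut, exactly one half lacks one chord and the other is full, so every extension comes
    from the first; the empty family is the case of [two_diagonals]. *)
Lemma noncrossing_two P S :
  polygon B P -> S \subset chords P -> pairwise_noncrossing S ->
  #|S|.+2 = #|branch_points B P| ->
  exists y1 y2, y1 != y2 /\ forall y, compatible P S y = (y == y1) || (y == y2).
Proof.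
have [m] := ubnP #|S|; elim: m P S => // m IH P S lt_m polyP sSP ncS.
have [S0|[x xS]] := set_0Vmem S.
  rewrite S0 cards0 => N2.
  have [i1 [j1 [i2 [j2 [[d1 a1] [d2 a2] ne all]]]]] := two_diagonals polyP (esym N2).
  have [y1 y1P E1] := exists_chord d1 a1; have [y2 y2P E2] := exists_chord d2 a2.
  have trans i j k l p q : same_ends i j p q -> same_ends k l p q -> same_ends i j k l.
    by rewrite /same_ends -!val_eqE /=; clear; lia.
  have sym i j k l : same_ends i j k l -> same_ends k l i j.
    by rewrite /same_ends -!val_eqE /=; clear; lia.
  exists y1, y2; split=> [|y].
    by apply: contraNneq ne => E; apply: trans _ _ _ _ _ _ E1 _; rewrite E.
  have -> : compatible P set0 y = (y \in chords P).
    rewrite /compatible in_set0; case: (y \in chords P) => //.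
    by apply/forall_inP=> z; rewrite in_set0.
  apply/idP/orP; last by case=> /eqP->.
  rewrite inE => /andP[yA dy].
  have inA z : z \in chords P -> z \in A by rewrite inE => /andP[].
  case/orP: (all _ _ dy (A_admissible yA)) => E; [left|right]; apply/eqP/A_inj=> //; try exact: inA.
    exact: trans _ _ _ _ _ _ E (sym _ _ _ _ E1).
  exact: trans _ _ _ _ _ _ E (sym _ _ _ _ E2).
have [p1 p2 -> cS ext] := noncrossing_glue polyP sSP ncS xS.
have nc1 := noncrossingS (subsetIl S (chords (slice P (e1 x) (e2 x)))) ncS.
have nc2 := noncrossingS (subsetIl S (chords (slice P (e2 x) (e1 x)))) ncS.
have [H1 _] := noncrossing_extend p1 (subsetIr _ _) nc1.
have [H2 _] := noncrossing_extend p2 (subsetIr _ _) nc2.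
have T1 := IH _ _ _ p1 (subsetIr _ _) nc1; have T2 := IH _ _ _ p2 (subsetIr _ _) nc2.
have F1 := noncrossing_full p1 (subsetIr _ _) nc1.
have F2 := noncrossing_full p2 (subsetIr _ _) nc2.
move: lt_m H1 H2 T1 T2 F1 F2; rewrite cS; set c1 := #|S :&: _|; set c2 := #|S :&: _|.
set N1 := #|branch_points B _|; set N2 := #|branch_points B _| => lt_m H1 H2 T1 T2 F1 F2 N.
have [full|nfull] := eqVneq c1.+1 N1.
  have [||y1 [y2 [ny E]]] := T2.
  - by move: lt_m; clear; lia.
  - by move: N full; clear; lia.
  by exists y1, y2; split=> // y; rewrite ext (F1 full) E.
have [||y1 [y2 [ny E]]] := T1.
- by move: lt_m; clear; lia.
- by move: N H1 H2 nfull; clear; lia.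
exists y1, y2; split=> // y; rewrite ext E F2 ?orbF //.
by move: N H1 H2 nfull; clear; lia.
Qed.

Theorem dissection_pure_thin : polygon B setT -> pure dissection /\ thin dissection.
Proof.
move=> polyT; pose N := #|branch_points B setT|.
have chordsT : chords setT = A.
  by apply/setP=> x; rewrite inE; case: (boolP (x \in A)) => //= /A_diagonal.
have disjP S : dissection S -> S \subset chords setT /\ pairwise_noncrossing S.
  by rewrite chordsT.
have add S y : dissection S -> compatible setT S y -> dissection (y |: S).
  move=> [sS ncS] /and3P[]; rewrite chordsT => yA yS /forall_inP ncy; split.
    by rewrite subUset sub1set yA.
  move=> a b /setU1P[->|aS] /setU1P[->|bS].
  - exact: crossesxx.
  - exact: ncy.
  - by rewrite crosses_sym ncy.
  - exact: ncS.
have bound S : dissection S -> #|S| < N.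
  by case/disjP=> s nc; have [] := noncrossing_extend polyT s nc.
have facetE F : facet dissection F <-> dissection F /\ #|F|.+1 = N.
  split=> [[dF maxF]|[dF cF]].
    split=> //; apply/eqP; rewrite eqn_leq bound //= leqNgt; apply/negP=> lt.
    have [s nc] := disjP F dF; have [_ /(_ lt)[y cy]] := noncrossing_extend polyT s nc.
    have /and3P[_ /negP yF _] := cy; apply: yF.
    by rewrite -(maxF _ (add _ _ dF cy) (subsetUr _ _)) setU11.
  split=> // S dS sFS; apply/esym/eqP; rewrite eqEcard sFS -ltnS cF.
  exact: bound.
split=> [F F' /facetE[_ E] /facetE[_ E']|S [dS [F dF cF] maxS]].
  by apply: succn_inj; rewrite E E'.
have [s nc] := disjP S dS.
(* [F] has the largest size of a simplex, so it admits no extension and has [N - 1] members. *)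
have cS : #|S|.+2 = N.
  apply/eqP; rewrite eqn_leq -cF bound //= leqNgt; apply/negP=> lt.
  have [sF ncF] := disjP F dF; have [_ /(_ lt)[y cy]] := noncrossing_extend polyT sF ncF.
  have /and3P[_ yF _] := cy.
  by have := maxS _ (add _ _ dF cy); rewrite cardsU1 yF cF ltnn.
have [y1 [y2 [ny E]]] := noncrossing_two polyT s nc cS.
have comp y : compatible setT S y -> y \notin S by case/and3P.
have [y1S y2S] : y1 \notin S /\ y2 \notin S.
  by split; apply: comp; rewrite E eqxx ?orbT.
exists (y1 |: S), (y2 |: S); split.
  apply: contraNneq y1S => E12; have := setU11 y1 S.
  by rewrite E12 in_setU1 (negbTE ny).
have fac y : compatible setT S y -> facet dissection (y |: S) /\ S \subset y |: S.
  move=> cy; split; last exact: subsetUr.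
  by apply/facetE; rewrite cardsU1 comp // cS; split=> //; apply: add.
move=> G; split=> [[/facetE[dG cG] sSG]|[]->]; last 2 first.
- by apply: fac; rewrite E eqxx.
- by apply: fac; rewrite E eqxx orbT.
have cD : #|G :\: S| = 1.
  rewrite cardsD (setIidPr sSG); move: cG cS; clear; lia.
have /eqP/cards1P[y Ey] := cD.
have EG : G = y |: S by rewrite -[LHS](setID G S) (setIidPr sSG) Ey setUC.
have /setDP[yG yS] : y \in G :\: S by rewrite Ey set11.
have : compatible setT S y.
  case: dG => /subsetP sG ncG; apply/and3P; split=> //; first by rewrite chordsT sG.
  by apply/forall_inP=> z /(subsetP sSG); apply: ncG.
by rewrite E EG => /orP[] /eqP->; [left|right].
Qed.

End Chords.

(** * Branches, the contour walk and the leaf numbering *)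

Section Branches.
Variable T : disk_tree.
Implicit Types (u v w x y z c : T) (s p : seq T).

Definition avoid v : rel T := fun x y => [&& adj x y, x != v & y != v].
(** The default is taken only at [x = v]; thanks to it the ends of a path count among the vertices
    separating them. *)
Definition branch v x := odflt v [pick c | adj v c && connect (avoid v) c x].

Lemma adjC : symmetric (@adj T). Proof. exact: dt_adj_sym. Qed.
Lemma adjxx x : adj x x = false. Proof. exact: dt_adj_irr. Qed.
Lemma adj_neq x y : adj x y -> x != y.
Proof. by apply: contraTneq => ->; rewrite adjxx. Qed.

Lemma connect_avoid_sym v : connect_sym (avoid v).
Proof.
by apply: sym_connect_sym => x y; rewrite /avoid adjC; congr (_ && _); rewrite andbC.
Qed.

Lemma path_avoid v x p : v \notin x :: p -> path (@adj T) x p = path (avoid v) x p.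
Proof.
elim: p x => //= y p IH x; rewrite in_cons negb_or => /andP[nvx nv].
rewrite -IH // /avoid; rewrite in_cons negb_or in nv; case/andP: nv => nvy _.
by rewrite ![_ == v]eq_sym nvx nvy !andbT.
Qed.

Lemma avoid_path v x p : path (avoid v) x p -> x != v -> v \notin x :: p.
Proof.
elim: p x => /= [|y p IH] x; first by rewrite inE eq_sym.
by case/andP=> /and3P[_ _ nyv] /IH/(_ nyv) nv nxv; rewrite in_cons negb_or eq_sym nxv.
Qed.

Lemma connect_avoid_neq v x y : connect (avoid v) x y -> x != v -> y != v.
Proof.
case/connectP=> p /avoid_path H -> /H; apply: contraNneq => <-; exact: mem_last.
Qed.

(** Otherwise a simple path from [c] to [c'] off [v] would close up through [v] to a cycle of length
    at least three. *)
Lemma acyclic_branch v c c' :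
  adj v c -> adj v c' -> connect (avoid v) c c' -> c = c'.
Proof.
move=> vc vc' /connectP[p0 /shortenP[p pth unip _]] Ec'.
have nv := avoid_path pth (_ : c != v); rewrite eq_sym adj_neq // in nv.
case: p pth unip nv Ec' => [//|d p] pth unip /(_ isT) nv Ec'.
have := @dt_acyclic T (v :: c :: d :: p); rewrite /ucycle => /(_ _)/wrap[] //.
apply/andP; split; last by rewrite cons_uniq nv.
rewrite -path_avoid // in pth.
have -> : cycle (@dt_adj T) (v :: c :: d :: p) =
    adj v c && (path (@adj T) c (d :: p) && adj (last c (d :: p)) v).
  by rewrite -rcons_path.
by rewrite vc pth -Ec' adjC vc'.
Qed.

Lemma branch_exists v x : x != v -> exists2 c, adj v c & connect (avoid v) c x.
Proof.
move=> nxv; have /connectP[p0 pth0 Ex] := @dt_connected T v x.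
case/shortenP: pth0 Ex => -[|c p] /= pth unip _ Ex; first by rewrite Ex eqxx in nxv.
case/andP: pth => vc pth; exists c => //; apply/connectP; exists p => //.
by rewrite -path_avoid //; case/andP: unip.
Qed.

Lemma branchP v x : x != v -> adj v (branch v x) /\ connect (avoid v) (branch v x) x.
Proof.
move=> /branch_exists[c vc cx]; rewrite /branch; case: pickP => [c' /andP[]|] //=.
by move/(_ c); rewrite vc cx.
Qed.

Lemma branchvv v : branch v v = v.
Proof.
rewrite /branch; case: pickP => //= c /andP[vc cv].
by have := connect_avoid_neq cv; rewrite eqxx eq_sym adj_neq // => /(_ isT).
Qed.

Lemma branch_eq v c x : adj v c -> connect (avoid v) c x -> branch v x = c.
Proof.
move=> vc cx; have nxv : x != v.
  by apply: connect_avoid_neq cx _; rewrite eq_sym adj_neq.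
have [vb bx] := branchP nxv; apply: acyclic_branch vb vc _.
by apply: connect_trans bx _; rewrite connect_avoid_sym.
Qed.

Lemma branch_adj v c : adj v c -> branch v c = c.
Proof. by move=> vc; apply: branch_eq. Qed.

Lemma branch_connect v x y : connect (avoid v) x y -> branch v x = branch v y.
Proof.
have [-> /connectP[p pth ->]|nxv xy] := eqVneq x v.
  by case: p pth => //= z p /andP[/and3P[]]; rewrite eqxx.
have [vb bx] := branchP nxv; apply/esym/branch_eq => //.
exact: connect_trans bx xy.
Qed.

Lemma branch_step v x y : adj x y -> x != v -> y != v -> branch v x = branch v y.
Proof. by move=> xy nx ny; apply/branch_connect/connect1; rewrite /avoid xy nx. Qed.

Lemma adj_branch v x : x != v -> adj v (branch v x).
Proof. by case/branchP. Qed.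

Lemma branch_neq v x : x != v -> branch v x != v.
Proof. by move/adj_branch/adj_neq; rewrite eq_sym. Qed.

(** A path off [v] from [branch v x] to [x] cannot meet [u], which is in another branch; preceded by
    [v], it is a path off [u]. *)
Lemma branch_beyond u v x : u != v -> branch v x != branch v u -> branch u x = branch u v.
Proof.
move=> nuv; have [->|nxv] := eqVneq x v; first by [].
have [vb bx] := branchP nxv => ne; apply/esym/branch_connect.
case/connectP: bx => p pth Ex; apply/connectP; exists (branch v x :: p) => //.
rewrite -path_avoid /=; last first.
  apply/negP; rewrite in_cons (negbTE nuv) /= => up; case/negP: ne.
  by rewrite -(branch_connect (path_connect pth up)) (branch_adj vb).
rewrite -/(adj _ _) vb /=; move: (avoid_path pth (branch_neq nxv)) => nv.
by rewrite (path_avoid nv).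
Qed.

(** Removing an edge leaves two components. This is the tool for moving a statement from one end of
    an edge to the other. *)
Lemma branch_edge x y z : adj x y -> (branch x z == y) = (branch y z != x).
Proof.
move=> xy; have nxy := adj_neq xy; have yx : adj y x by rewrite adjC.
have [->|nzx] := eqVneq z x; first by rewrite branchvv branch_adj // eqxx (negbTE nxy).
have [->|nzy] := eqVneq z y; first by rewrite branchvv branch_adj // eqxx eq_sym nxy.
apply/idP/idP=> [/eqP bx|]; last first.
  apply: contraNT => bx; apply/eqP.
  rewrite -[RHS](branch_adj yx); apply: branch_beyond; first by rewrite eq_sym.
  by rewrite (branch_adj xy).
apply/eqP=> byx; have [_] := branchP nzx; rewrite bx.
case/connectP=> p0 /shortenP[[|w p] pth unip _] Ez; first by rewrite Ez eqxx in nzy.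
have nx := avoid_path pth (_ : y != x); rewrite eq_sym nxy in nx; move/(_ isT): nx => nx.
rewrite -path_avoid //= in pth; case/andP: pth => yw pth.
suff Ew : branch y z = w.
  by move: nx; rewrite -byx Ew !inE eqxx orbT.
apply: branch_eq yw _; apply/connectP; exists p => //.
by rewrite -path_avoid //; case/andP: unip.
Qed.
End Branches.

(** Steps are forced, so two walks from [x] follow each other until one of them stops. *)
Lemma connect_functional (X : finType) (R : rel X) x y z :
  (forall a b c, R a b -> R a c -> b = c) ->
  connect R x y -> connect R x z -> connect R y z || connect R z y.
Proof.
move=> funR /connectP[p]; elim: p x => [|a p IH] x /= => [_ -> -> //|].
case/andP=> xa pth Ey xz; have [E|nzx] := eqVneq z x.
  by rewrite orbC E; apply/orP; left; apply/connectP; exists (a :: p); rewrite //= xa.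
case/connectP: xz => -[|b q] /= => [_ E|/andP[xb qth] Ez]; first by rewrite E eqxx in nzx.
rewrite (funR _ _ _ xb xa) in qth Ez *.
by apply: IH pth Ey _; apply/connectP; exists q.
Qed.

(** * Rotation around a vertex *)

Section Rotation.
Variable T : disk_tree.
Implicit Types (u v w x y z c l : T).

Definition degree_of v := #|adj v|.

Lemma interior_ge3 v : interior v -> 3 <= degree_of v.
Proof. exact: dt_interior_degree. Qed.

Lemma adj_cw v c : adj v c -> adj v (cw v c).
Proof. exact: dt_rot_adj. Qed.

Lemma leaf_adj_eq l a b : leaf l -> adj l a -> adj l b -> a = b.
Proof.
move=> /eqP/mem_card1[x Ex] la lb.
have one c : adj l c -> c = x by move=> lc; apply/eqP; rewrite -[_ == _]Ex.
by rewrite (one a) // (one b).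
Qed.

Lemma adj_iter_cw v c k : adj v c -> adj v (iter k (cw v) c).
Proof. by move=> vc; elim: k => //= k; apply: adj_cw. Qed.

Lemma cw_surj v c : adj v c -> exists2 c', adj v c' & cw v c' = c.
Proof.
move=> vc; have /connectP[p pth Ec] := dt_rot_cyclic (adj_cw vc) vc.
have [k Ek] : exists k, c = iter k (cw v) (cw v c).
  exists (size p); rewrite {1}Ec; move: pth; clear.
  elim: p (cw v c) => //= a p IH x /andP[/eqP <- /IH ->].
  by rewrite -iterSr.
by exists (iter k (cw v) c); [apply: adj_iter_cw | rewrite -iterS iterSr -Ek].
Qed.

Lemma cw_inj v : {in adj v &, injective (cw v)}.
Proof.
apply/imset_injP; rewrite eqn_leq leq_imset_card /=; apply/subset_leq_card.
apply/subsetP=> c vc; have [c' vc' <-] := cw_surj vc.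
exact: imset_f.
Qed.

Lemma order_cw v c : adj v c -> order (cw v) c = degree_of v.
Proof.
move=> vc; apply: eq_card => x; rewrite -topredE /=; apply/idP/idP => [|vx].
  by move/iter_findex<-; apply: adj_iter_cw.
exact: dt_rot_cyclic.
Qed.

Lemma iter_degree v c : adj v c -> iter (degree_of v) (cw v) c = c.
Proof.
move=> vc; rewrite -(order_cw vc); apply: (@iter_order_in _ (cw v) (adj v)) => //.
  by move=> x; apply: adj_cw.
exact: cw_inj.
Qed.

(** The source of [eq_turn]: among counts up to the degree, only the two extremes are identified. *)
Lemma iter_cw_eq v c a b : adj v c -> a <= degree_of v -> b <= degree_of v ->
  (iter a (cw v) c == iter b (cw v) c) =
  [|| a == b, (a == 0) && (b == degree_of v) | (a == degree_of v) && (b == 0)].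
Proof.
move=> vc; have inj i j : i < degree_of v -> j < degree_of v ->
    (iter i (cw v) c == iter j (cw v) c) = (i == j).
  rewrite -(order_cw vc) => lt_i lt_j; apply/eqP/eqP=> [E|->//].
  by rewrite -(findex_iter lt_i) E findex_iter.
have d0 : 0 < degree_of v by apply/card_gt0P; exists c.
move: inj (iter_degree vc) d0; set d := degree_of v => inj Ed d0.
have E0 : iter 0 (cw v) c = c by [].
move=> le_a le_b; have [Ea|na] := eqVneq a d; have [Eb|nb] := eqVneq b d.
- by rewrite Ea Eb !eqxx.
- rewrite Ea Ed -{1}E0 inj //; first by move: nb d0; clear; lia.
  by rewrite ltn_neqAle nb.
- rewrite Eb Ed -{2}E0 inj //; first by move: na d0; clear; lia.
  by rewrite ltn_neqAle na.
- rewrite inj ?ltn_neqAle ?na ?nb //; first by move: na nb; clear; lia.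
Qed.

Lemma cw_neq v c : interior v -> adj v c -> cw v c != c.
Proof.
move=> /interior_ge3 d3 vc.
have /= -> := @iter_cw_eq v c 1 0 vc; move: d3; clear; lia.
Qed.

End Rotation.

(** * Walks along the sides of a face, from leaf to leaf *)

Section Walks.
Variable T : disk_tree.
Implicit Types (u v w x y z c l m : T) (d e : side T).
Let sn : rel (side T) := @side_next T.

(** A step shrinks the set of vertices beyond the current side, which loses [y]; this measure makes
    walks end. *)
Lemma side_next_branch x y d z : sn (x, y) d ->
  [/\ adj d.1 d.2, branch d.1 z = d.2 -> branch x z = y &
      branch d.1 z = d.2 -> z != y].
Proof.
case/and3P=> /= xy iy /eqP->; have yx : adj y x by rewrite adjC.
have ne : cw y x != x by apply: cw_neq.
split=> [|/= E|/= E]; first exact: adj_cw.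
  by apply/eqP; rewrite (branch_edge _ xy) E.
by apply/eqP=> Ez; have := adj_neq (adj_cw yx); rewrite -E Ez branchvv eqxx.
Qed.

Lemma walk_branch d e : connect sn d e -> adj d.1 d.2 ->
  adj e.1 e.2 /\ forall z, branch e.1 z = e.2 -> branch d.1 z = d.2.
Proof.
case/connectP=> p; elim: p d => [|[a b] p IH] [x y] /= => [_ -> xy|].
  by split.
case/andP=> dd pth Ee xy; have [ab H _] := side_next_branch a dd.
have [e12 He] := IH (a, b) pth Ee ab; split=> // z /He /= Ez.
by have [_ + _] := side_next_branch z dd; apply.
Qed.

Lemma walk_branch_back d e z : connect sn d e -> adj d.1 d.2 ->
  branch d.2 z = d.1 -> branch e.2 z = e.1.
Proof.
move=> de d12 Ed; have [e12 He] := walk_branch de d12.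
apply/eqP; rewrite -[_ == _]negbK -branch_edge //; apply/eqP=> /He /eqP.
by rewrite branch_edge // Ed eqxx.
Qed.

Lemma walk_forward x y : adj x y ->
  exists a l, leaf l /\ connect sn (x, y) (a, l).
Proof.
have [n] := ubnP #|[pred z | branch x z == y]|; elim: n x y => // n IH x y lt_n xy.
have [ly|iy] := boolP (leaf y); first by exists x, y.
have xyn : sn (x, y) (y, cw y x) by rewrite /sn /side_next /interior /= xy iy eqxx.
have [yw _ _] := side_next_branch x xyn.
have [|a [l [ll wl]]] := IH y (cw y x) _ yw; last first.
  by exists a, l; split=> //; apply: connect_trans (connect1 xyn) wl.
rewrite ltnS in lt_n; apply: leq_trans lt_n; apply/proper_card/properP; split.
  apply/subsetP=> z; rewrite !inE => /eqP Ez.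
  by have [_ H _] := side_next_branch z xyn; rewrite H.
exists y; rewrite !inE; first by rewrite branch_adj.
apply/eqP=> E.
by have [_ _ H] := side_next_branch y xyn; have := H E; rewrite eqxx.
Qed.

Lemma walk_backward x y : adj x y ->
  exists l b, leaf l /\ connect sn (l, b) (x, y).
Proof.
have [n] := ubnP #|[pred z | branch y z == x]|; elim: n x y => // n IH x y lt_n xy.
have [lx|ix] := boolP (leaf x); first by exists x, y.
have [a xa Ea] := cw_surj xy; have ax : adj a x by rewrite adjC.
have axy : sn (a, x) (x, y) by rewrite /sn /side_next /interior /= ax ix Ea eqxx.
have [|l [b [ll wl]]] := IH a x _ ax; last first.
  by exists l, b; split=> //; apply: connect_trans wl (connect1 axy).
have nay : a != y by rewrite -Ea eq_sym cw_neq.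
have yx : adj y x by rewrite adjC.
rewrite ltnS in lt_n; apply: leq_trans lt_n; apply/proper_card/properP; split.
  apply/subsetP=> z; rewrite !inE => /eqP Ez.
  by rewrite branch_edge // Ez.
exists x; rewrite !inE; first by rewrite branch_adj.
by rewrite branchvv eq_sym adj_neq.
Qed.

Lemma side_next_fun d e e' : sn d e -> sn d e' -> e = e'.
Proof. by case/and3P=> _ _ /eqP-> /and3P[_ _ /eqP->]. Qed.

Lemma side_next_inj d d' e : sn d e -> sn d' e -> d = d'.
Proof.
case: d d' => [x y] [x' y'] /and3P[/= xy _ /eqP->] /and3P[/= xy' _ /eqP[Ey]].
rewrite -Ey in xy' *; rewrite adjC in xy; rewrite adjC in xy'.
by move/(cw_inj xy xy') ->.
Qed.

Lemma walk_end a l e : leaf l -> connect sn (a, l) e -> e = (a, l).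
Proof.
move=> ll /connectP[[|f p] //= /andP[/and3P[_ /= il _]]].
by rewrite /interior ll in il.
Qed.

Lemma walk_start e l b : leaf l -> connect sn e (l, b) -> e = (l, b).
Proof.
move=> ll /connectP[p]; case/lastP: p => [_ -> //|p f].
rewrite rcons_path last_rcons => /andP[_ /and3P[_ il /eqP->]] [E].
by rewrite /interior -E ll in il.
Qed.

(** Steps can be traced back uniquely because [cw] is injective on neighbours, and no step leads to
    a side that starts at a leaf. *)
Lemma walk_start_unique e b b' l l' : leaf l -> leaf l' ->
  connect sn (l, b) e -> connect sn (l', b') e -> (l, b) = (l', b').
Proof.
move=> ll ll' w w'; pose ns : rel (side T) := fun d f => sn f d.
have rev d f : connect ns d f = connect sn f d by apply: connect_rev.
rewrite -!rev in w w'.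
have nsF d f g : ns d f -> ns d g -> f = g by move=> a; apply: side_next_inj a.
by case/orP: (connect_functional nsF w w'); rewrite rev => /walk_start-> //.
Qed.

(** The end of the walk that starts on the pendant edge of [l]. Fixing the other vertices makes it a
    permutation of all vertices, so its orbits are cycles. *)
Definition next_leaf l : T :=
  odflt l [pick z | leaf l && leaf z &&
                    [exists a, [exists b, adj l b && connect sn (l, b) (a, z)]]].

Lemma next_leafP l b : leaf l -> adj l b ->
  leaf (next_leaf l) /\ exists2 a, adj a (next_leaf l) & connect sn (l, b) (a, next_leaf l).
Proof.
move=> ll lb; rewrite /next_leaf; case: pickP => [z|none] /=.
  case/andP=> /andP[_ lz] /existsP[a /existsP[b' /andP[lb' w]]].
  rewrite (leaf_adj_eq ll lb' lb) in w; split=> //; exists a => //.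
  by have [] := walk_branch w lb.
have [a [z [lz w]]] := walk_forward lb.
have := none z; rewrite ll lz /=; case/existsP; exists a.
by apply/existsP; exists b; rewrite lb.
Qed.

Lemma leaf_adj l : leaf l -> exists b, adj l b.
Proof. by move=> /eqP/mem_card1[b Eb]; exists b; have := Eb b; rewrite inE eqxx. Qed.

Lemma leaf_next l : leaf l -> leaf (next_leaf l).
Proof. by move=> ll; have [b lb] := leaf_adj ll; case: (next_leafP ll lb). Qed.

Lemma next_not_leaf l : ~~ leaf l -> next_leaf l = l.
Proof. by move=> /negbTE ll; rewrite /next_leaf; case: pickP => //= z; rewrite ll. Qed.

(* The side [d] lies on the left of the path from [l] to [next_leaf l]; these
   sides form a face, so faces correspond to leaves. *)
Definition side_at l d :=
  [&& adj d.1 d.2, branch d.2 l == d.1 & branch d.1 (next_leaf l) == d.2].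

Lemma leaf_branch l x z : leaf l -> adj x l -> branch x z = l -> z = l.
Proof.
move=> ll xl /eqP; rewrite branch_edge //; apply: contraNeq => nzl.
apply/eqP/(leaf_adj_eq ll); first exact: adj_branch.
by rewrite adjC.
Qed.

Lemma walk_avoid v d p : path sn d p -> adj d.1 d.2 -> d.1 != v ->
  (forall e, e \in d :: p -> e.2 != v) -> connect (avoid v) d.1 (last d p).2.
Proof.
elim: p d => [|f p IH] [x y] /= => [_ xy nx H|/andP[df pth] xy nx H].
  by apply: connect1; rewrite /avoid xy nx (H (x, y)) ?mem_head.
have [f12 _ _] := side_next_branch x df; have ny := H (x, y) (mem_head _ _).
have Ef : f.1 = y by case/and3P: df => _ _ /eqP->.
apply: (@connect_trans _ _ y); first by apply: connect1; rewrite /avoid xy nx.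
rewrite -[y in connect _ y]Ef; apply: IH => //; first by rewrite Ef.
by move=> e ef; apply: H; rewrite in_cons ef orbT.
Qed.

(** A walk that misses [v] stays in one component of the tree minus [v]. One that arrives from [c]
    proceeds to [cw v c], with [l] left behind in the branch [c] and the final leaf ahead in the
    branch [cw v c]. *)
Lemma branch_at_turn l b v : leaf l -> adj l b -> interior v ->
  branch v (next_leaf l) = branch v l \/
  connect sn (l, b) (branch v l, v) /\
  branch v (next_leaf l) = cw v (branch v l).
Proof.
move=> ll lb iv; have [ln [a al w]] := next_leafP ll lb.
have nvl : l != v by apply: contraTneq ll => ->.
have nvn : next_leaf l != v by apply: contraTneq ln => ->.
case/connectP: (w) => p pth Ep.
have [/existsP[c cp]|none] := boolP [exists c, (c, v) \in (l, b) :: p]; last first.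
  left; apply/esym/branch_connect; rewrite -[next_leaf l]/(a, next_leaf l).2 Ep.
  apply: walk_avoid pth lb nvl _ => e ep; apply: contraNneq none => <-.
  by apply/existsP; exists e.1; rewrite -surjective_pairing.
have w1 := path_connect pth cp.
have w2 : connect sn (c, v) (a, next_leaf l).
  case/splitPl: cp pth Ep => p1 p2 E1; rewrite cat_path last_cat E1 => /andP[_ pth2] E2.
  by apply/connectP; exists p2.
right; have := walk_branch_back w1 lb (branch_adj (_ : adj b l)).
rewrite adjC => /(_ lb) /= ->; split=> //.
case/connectP: w2 => -[|d q] /= => [_ [_ E]|/andP[cd qth] E].
  by rewrite E eqxx in nvn.
have [d12 _ _] := side_next_branch v cd.
have wd : connect sn d (a, next_leaf l) by apply/connectP; exists q.
have [_ H] := walk_branch wd d12; have := H _ (branch_adj al).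
by case/and3P: cd => _ _ /eqP->.
Qed.

(** Reduces reachability along a face to two conditions on branches. Conversely, if these hold at
    [(x, y)] with [y] interior, the branch at [y] changes, and [branch_at_turn] supplies the
    walk. *)
Lemma side_at_walk l b d : leaf l -> adj l b -> connect sn (l, b) d = side_at l d.
Proof.
move=> ll lb; have [ln [a al w]] := next_leafP ll lb; case: d => x y.
have bl : adj b l by rewrite adjC.
apply/idP/and3P=> /= [w1|[xy /eqP El /eqP En]].
  have [xy _] := walk_branch w1 lb; split=> //.
    by rewrite (walk_branch_back w1 lb) //= branch_adj.
  case/orP: (connect_functional side_next_fun w w1) => [/(walk_end ln)[-> ->]|w2].
    by rewrite branch_adj.
  by have [_ ->] := walk_branch w2 xy; rewrite //= branch_adj.
have [ly|iy] := boolP (leaf y).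
  have Ey := leaf_branch ly xy En.
  have -> : x = a by apply: (leaf_adj_eq ly); rewrite adjC // -Ey.
  by rewrite -Ey.
have [E|[w1 _]] := branch_at_turn ll lb iy; last by rewrite -El.
by have := branch_edge (next_leaf l) xy; rewrite En E El !eqxx.
Qed.

Lemma side_at_unique l l' d : leaf l -> leaf l' -> side_at l d -> side_at l' d -> l = l'.
Proof.
move=> ll ll'; have [b lb] := leaf_adj ll; have [b' lb'] := leaf_adj ll'.
rewrite -(side_at_walk _ ll lb) -(side_at_walk _ ll' lb') => w w'.
by have [] := walk_start_unique ll ll' w w'.
Qed.

Lemma side_at_exists d : adj d.1 d.2 -> exists2 l, leaf l & side_at l d.
Proof.
case: d => x y xy; have [l [b [ll w]]] := walk_backward xy; exists l => //.
suff lb : adj l b by rewrite -(side_at_walk _ ll lb).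
case/connectP: w => -[|f p] /=; first by move=> _ [<- <-].
by case/andP=> /and3P[].
Qed.

Lemma side_at_next l v c : leaf l -> interior v -> adj c v ->
  side_at l (c, v) = side_at l (v, cw v c).
Proof.
move=> ll iv cv; have [b lb] := leaf_adj ll.
have cd : sn (c, v) (v, cw v c) by rewrite /sn /side_next /= cv iv eqxx.
rewrite -!(side_at_walk _ ll lb); apply/idP/idP=> [w|].
  exact: connect_trans w (connect1 cd).
case/connectP=> p; case/lastP: p => [_ E|p f].
  by case: E iv => ->; rewrite /interior ll.
rewrite rcons_path last_rcons => /andP[pth fd] Ef; rewrite -Ef in fd.
by apply/connectP; exists p => //; apply: side_next_inj cd fd.
Qed.

Lemma next_leaf_neq l : leaf l -> next_leaf l != l.
Proof.
move=> ll; have [b lb] := leaf_adj ll; have [ln [a al w]] := next_leafP ll lb.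
apply/eqP=> E; rewrite (side_at_walk _ ll lb) in w; case/and3P: w => /= _ /eqP El _.
by move: El al; rewrite E branchvv => <-; rewrite adjxx.
Qed.

Lemma next_leaf_inj : injective next_leaf.
Proof.
move=> l l'; have [ll|nl] := boolP (leaf l); have [ll'|nl'] := boolP (leaf l').
- have [b lb] := leaf_adj ll; have [ln [a al w]] := next_leafP ll lb.
  have [b' lb'] := leaf_adj ll'; have [ln' [a' al' w']] := next_leafP ll' lb'.
  move=> E; rewrite -E in al' w'; rewrite adjC in al; rewrite adjC in al'.
  rewrite (leaf_adj_eq ln al' al) (side_at_walk _ ll' lb') in w'.
  rewrite (side_at_walk _ ll lb) in w; exact: side_at_unique w w'.
- by rewrite (next_not_leaf nl') => E; rewrite -E leaf_next in nl'.
- by rewrite (next_not_leaf nl) => E; rewrite E leaf_next in nl.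
- by rewrite !next_not_leaf.
Qed.
End Walks.

(** * The single cycle of leaves, and medians *)

Section Contour.
Variable T : disk_tree.
Implicit Types (u v w x y z c l m : T) (d e : side T).

Lemma leaf_iter_next l k : leaf l -> leaf (iter k (@next_leaf T) l).
Proof. by move=> ll; elim: k => //= k; apply: leaf_next. Qed.

(** The leaf after [l] lies beyond the edge and the orbit returns to [l], which does not; where the
    orbit first comes out again, it runs along the other side of the edge. *)
Lemma side_at_rev l x y : leaf l -> side_at l (x, y) ->
  exists k, side_at (iter k (@next_leaf T) l) (y, x).
Proof.
move=> ll /and3P[/= xy /eqP El /eqP En].
have nl : branch x l != y by rewrite branch_edge // El eqxx.
have ex : exists k, (0 < k) && (branch x (iter k (@next_leaf T) l) != y).
  by exists (order (@next_leaf T) l); rewrite order_gt0 (iter_order (@next_leaf_inj T)).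
case: (ex_minnP ex) => -[|[|k]] /andP[] //; first by rewrite /= En eqxx.
move=> _ out min; exists k.+1; apply/and3P; split=> /=; first by rewrite adjC.
  by apply: contraT => H; have := min k.+1 H; rewrite ltnn.
by rewrite -[_ == _]negbK -branch_edge.
Qed.

(** Going around [v] alternates between following a face through its corner at [v] and switching to
    the other side of the edge reached. *)
Lemma side_at_orbit_vertex l m v c c' : leaf l -> leaf m ->
  side_at l (c, v) -> side_at m (c', v) -> fconnect (@next_leaf T) l m.
Proof.
move=> ll lm sl sm; have /and3P[/= cv _ _] := sl; have /and3P[/= c'v _ _] := sm.
rewrite adjC in cv; rewrite adjC in c'v.
have [lv|iv] := boolP (leaf v).
  rewrite (leaf_adj_eq lv cv c'v) in sl.
  by rewrite (side_at_unique ll lm sl sm).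
have [n En] : exists n, iter n (cw v) c = c'.
  by have /iter_findex := dt_rot_cyclic cv c'v; eexists; eassumption.
elim: n m c' lm c'v sm En => [|k IH] m c' lm vc' sm Ek.
  by rewrite -Ek in sm; rewrite (side_at_unique ll lm sl sm).
pose d := iter k (cw v) c; have vd : adj v d by apply: adj_iter_cw.
have dv : adj d v by rewrite adjC.
have [m' lm' sm'] := @side_at_exists T (d, v) dv.
apply: connect_trans (IH m' d lm' vd sm' erefl) _.
move: sm'; rewrite side_at_next // -[cw v d]/(iter k.+1 (cw v) c) Ek.
case/(side_at_rev lm')=> j /(side_at_unique (leaf_iter_next _ lm') lm)/(_ sm) <-.
exact: fconnect_iter.
Qed.

Lemma side_at_orbit l m v c v' c' : leaf l -> leaf m ->
  side_at l (c, v) -> side_at m (c', v') -> fconnect (@next_leaf T) l m.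
Proof.
move=> ll lm sl sm; have /connectP[p pth Ep] := @dt_connected T v v'.
elim: p v c l ll sl pth Ep => [|w p IH] v c l ll sl /= => [_ E|/andP[vw pth] Ep].
  by rewrite E in sm; apply: side_at_orbit_vertex ll lm sl sm.
have wv : adj w v by rewrite adjC.
have [m1 lm1 sm1] := @side_at_exists T (w, v) wv.
apply: connect_trans (side_at_orbit_vertex ll lm1 sl sm1) _.
have [k sk] := side_at_rev lm1 sm1.
apply: connect_trans (fconnect_iter _ k m1) _.
exact: IH (leaf_iter_next k lm1) sk pth Ep.
Qed.

Lemma side_at_leaf l b : leaf l -> adj l b -> side_at l (l, b).
Proof. by move=> ll lb; rewrite -(side_at_walk _ ll lb). Qed.

Lemma leaf_orbit l m : leaf l -> leaf m -> fconnect (@next_leaf T) l m.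
Proof.
move=> ll lm; have [b lb] := leaf_adj ll; have [b' lb'] := leaf_adj lm.
exact: side_at_orbit ll lm (side_at_leaf ll lb) (side_at_leaf lm lb').
Qed.

Lemma exists_leaf : exists l : T, leaf l.
Proof.
have /card_gt0P[v _] := @dt_nonempty T; have [lv|/interior_ge3 d3] := boolP (leaf v).
  by exists v.
have /card_gt0P[c vc] : 0 < #|@adj T v| by apply: leq_trans d3.
by have [a [l [ll _]]] := walk_forward (vc : adj v c); exists l.
Qed.

Lemma median_step (a b c v : T) : leaf c -> a != c ->
  branch v a != branch v b -> branch v c = branch v a ->
  exists2 d, branch d a != branch d b &
    #|[pred z | branch d z == branch d c]| < #|[pred z | branch v z == branch v c]|.
Proof.
move=> lc nac ne E; have nvc : c != v.
  apply: contraNneq nac => Ev; apply: contraT; rewrite Ev => nav.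
  by have := branch_neq nav; rewrite -E Ev branchvv eqxx.
set d := branch v c in E *; have vd : adj v d by apply: adj_branch.
have dv : adj d v by rewrite adjC.
have Eb : branch d b = v.
  by apply/eqP; rewrite branch_edge // E eq_sym.
have na : branch d a != v by rewrite branch_edge // E eqxx.
exists d; first by rewrite Eb.
have nc : branch d c != v by rewrite branch_edge // eqxx.
have ndc : d != c.
  apply: contraNneq nac => Ed; apply/eqP; rewrite Ed in vd E.
  by apply: leaf_branch lc vd _; rewrite -E.
apply/proper_card/properP; split.
  apply/subsetP=> z; rewrite !inE => /eqP Ez; rewrite branch_edge //.
  by rewrite Ez.
exists d; rewrite !inE; first by rewrite branch_adj.
by rewrite branchvv eq_sym branch_neq // eq_sym.
Qed.

(** Among the vertices separating [a] from [b], one with the smallest branch towards [c] has [c] in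
    neither of their branches: otherwise [median_step] moves one step towards [c] and shrinks that
    branch. *)
Lemma exists_median (a b c : T) : leaf a -> leaf b -> leaf c ->
  a != b -> b != c -> a != c -> exists v,
  [/\ interior v, branch v a != branch v b, branch v b != branch v c &
      branch v a != branch v c].
Proof.
move=> la lb lc nab nbc nac.
have Pa : branch a a != branch a b by rewrite branchvv eq_sym branch_neq // eq_sym.
have [v ne min] := @arg_minnP T a (fun v => branch v a != branch v b)
  (fun v => #|[pred z | branch v z == branch v c]|) Pa.
have nva : branch v c != branch v a.
  apply/eqP=> E; have [d nd] := median_step lc nac ne E.
  by rewrite ltnNge min.
have nvb : branch v c != branch v b.
  apply/eqP=> E; have [|d nd] := @median_step b a c v lc nbc _ E.
    by rewrite eq_sym.
  by rewrite ltnNge min // eq_sym.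
exists v; split; rewrite // 1?eq_sym //.
apply/negP=> lv; have one x y : x != v -> y != v -> branch v x = branch v y.
  by move=> nx ny; apply: (leaf_adj_eq lv); apply: adj_branch.
have [Eav|nav] := eqVneq a v.
  by case/eqP: nvb; apply: one; rewrite -Eav eq_sym.
have [Ebv|nbv] := eqVneq b v.
  by case/eqP: nva; apply: one; rewrite -?Ebv // eq_sym.
by case/eqP: ne; apply: one.
Qed.
End Contour.

(** * Numbering the leaves and counting turns *)

Section Numbering.
Variables (T : disk_tree) (r : T).
Hypothesis leaf_r : leaf r.
Implicit Types (u v w x y z c l m : T) (i j k t : nat).

Definition nleaves := order (@next_leaf T) r.
Definition nth_leaf k : T := iter k (@next_leaf T) r.

Lemma leaf_nth k : leaf (nth_leaf k). Proof. exact: leaf_iter_next. Qed.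

Lemma nth_leafS k : nth_leaf k.+1 = next_leaf (nth_leaf k). Proof. by []. Qed.

Lemma nth_leaf_last : nth_leaf nleaves = r.
Proof. exact: iter_order (@next_leaf_inj T) r. Qed.

Lemma nth_leaf_inj i j : i < nleaves -> j < nleaves ->
  nth_leaf i = nth_leaf j -> i = j.
Proof. by move=> lt_i lt_j E; rewrite -(findex_iter lt_i) [X in findex _ _ X]E findex_iter. Qed.

Lemma nth_leaf_surj l : leaf l -> exists2 k, k < nleaves & l = nth_leaf k.
Proof.
move=> /(leaf_orbit leaf_r) c; exists (findex (@next_leaf T) r l).
  exact: findex_max.
by rewrite /nth_leaf iter_findex.
Qed.

(* The branch at [v] of the current leaf turns clockwise along the contour and
   leaves each branch only once, hence at most [degree_of v] turns in all. *)
Definition turn_at v t := branch v (nth_leaf t) != branch v (nth_leaf t.+1).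
Definition turns_before v k := count (turn_at v) (iota 0 k).

Lemma turns_beforeS v k : turns_before v k.+1 = turns_before v k + turn_at v k.
Proof. by rewrite /turns_before -addn1 iotaD count_cat /= add0n addn0. Qed.

Lemma turns_before_homo v i j : i <= j -> turns_before v i <= turns_before v j.
Proof.
move=> /subnKC <-; elim: (j - i) => [|k IH]; first by rewrite addn0.
by rewrite addnS turns_beforeS (leq_trans IH) // leq_addr.
Qed.

Lemma turn_at_side v t : interior v -> turn_at v t ->
  side_at (nth_leaf t) (branch v (nth_leaf t), v) /\
  branch v (nth_leaf t.+1) = cw v (branch v (nth_leaf t)).
Proof.
move=> iv; rewrite /turn_at nth_leafS => ne.
have [b lb] := leaf_adj (leaf_nth t).
have [E|[w E]] := branch_at_turn (leaf_nth t) lb iv; first by rewrite E eqxx in ne.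
by rewrite -(side_at_walk _ (leaf_nth t) lb).
Qed.

Lemma branch_nth_leaf v k : interior v ->
  branch v (nth_leaf k) = iter (turns_before v k) (cw v) (branch v r).
Proof.
move=> iv; elim: k => // k IH; rewrite turns_beforeS.
have [tk|] := boolP (turn_at v k).
  by have [_ ->] := turn_at_side iv tk; rewrite addn1 iterS -IH.
by rewrite /turn_at negbK => /eqP <-; rewrite addn0.
Qed.

Lemma interior_neq_leaf v l : interior v -> leaf l -> l != v.
Proof. by move=> iv; apply: contraTneq => ->. Qed.

(** Two turns out of the same branch [c] would put the side [(c, v)] on the walks of two different
    leaves. *)
Lemma turns_before_le v k : interior v -> k <= nleaves ->
  turns_before v k <= degree_of v.
Proof.
move=> iv /(turns_before_homo v)/leq_trans; apply.
rewrite /turns_before -size_filter -(size_map (fun t => branch v (nth_leaf t))).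
rewrite /degree_of cardE; apply: uniq_leq_size.
  rewrite map_inj_in_uniq ?filter_uniq ?iota_uniq // => t t'.
  rewrite !mem_filter !mem_iota /= !add0n => /andP[tt lt_t] /andP[tt' lt_t'] E.
  have [s _] := turn_at_side iv tt; have [s' _] := turn_at_side iv tt'.
  apply: nth_leaf_inj => //; rewrite -E in s'.
  exact: side_at_unique (leaf_nth t) (leaf_nth t') s s'.
move=> c /mapP[t _ ->]; rewrite mem_enum; apply: adj_branch.
exact: interior_neq_leaf (leaf_nth t).
Qed.

Lemma branch_root_adj v : interior v -> adj v (branch v r).
Proof. by move=> iv; apply/adj_branch/interior_neq_leaf. Qed.

Lemma eq_turn_branch v i j : interior v -> i <= nleaves -> j <= nleaves ->
  eq_turn (degree_of v) (turns_before v i) (turns_before v j) =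
  (branch v (nth_leaf i) == branch v (nth_leaf j)).
Proof.
move=> iv le_i le_j; rewrite !branch_nth_leaf // iter_cw_eq ?turns_before_le //; last first.
  exact: branch_root_adj.
have := turns_before_le iv le_i; have := turns_before_le iv le_j.
move: (interior_ge3 iv) (turns_before v i) (turns_before v j); rewrite /eq_turn /gap.
move: (degree_of v); clear; lia.
Qed.

Lemma near_turn_branch v i j : interior v -> i <= nleaves -> j <= nleaves ->
  near_turn (degree_of v) (turns_before v i) (turns_before v j) =
  [|| branch v (nth_leaf i) == branch v (nth_leaf j),
      branch v (nth_leaf j) == cw v (branch v (nth_leaf i)) |
      branch v (nth_leaf i) == cw v (branch v (nth_leaf j))].
Proof.
move=> iv le_i le_j; rewrite !branch_nth_leaf //.
have := turns_before_le iv le_i; have := turns_before_le iv le_j.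
have := branch_root_adj iv; set c := branch v r => vc.
move: (interior_ge3 iv) (turns_before v i) (turns_before v j) => d3 a b le_b le_a.
(* The count [degree_of v] stands for a full revolution, so the branch after it has count [1]. *)
have cwE (k m : nat) : k <= degree_of v -> m <= degree_of v ->
    (iter k (cw v) c == cw v (iter m (cw v) c)) =
    if m == degree_of v then k == 1 else
    [|| k == m.+1, (k == 0) && (m.+1 == degree_of v) | (k == degree_of v) && (m.+1 == 0)].
  move=> le_k le_m; have [->|nm] := eqVneq m (degree_of v).
    rewrite iter_degree // -[cw v c]/(iter 1 (cw v) c) iter_cw_eq //; last by move: d3; clear; lia.
    by move: d3; clear; lia.
  rewrite -iterS iter_cw_eq //; last by rewrite ltn_neqAle nm.
rewrite !cwE // iter_cw_eq // /near_turn /gap.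
move: le_a le_b d3; move: (degree_of v); clear.
by move=> d *; case: ifP => ?; case: ifP => ?; lia.
Qed.

Definition interior_vertex := {v : T | interior v}.
Implicit Types p q : interior_vertex.

Definition node_degree p := degree_of (val p).
Definition node_turns p (i : 'I_nleaves) := turns_before (val p) i.

Lemma node_eq_turn p (i j : 'I_nleaves) :
  eq_turn (node_degree p) (node_turns p i) (node_turns p j) =
  (branch (val p) (nth_leaf i) == branch (val p) (nth_leaf j)).
Proof. by apply: eq_turn_branch (valP p) _ _; apply: ltnW. Qed.

Lemma node_degree_ge3 p : 3 <= node_degree p.
Proof. exact: interior_ge3 (valP p). Qed.

Lemma node_turns_homo p (i j : 'I_nleaves) :
  i <= j -> node_turns p i <= node_turns p j.
Proof. exact: turns_before_homo. Qed.

Lemma node_turns_le p (i : 'I_nleaves) : node_turns p i <= node_degree p.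
Proof. by apply: turns_before_le (valP p) _; apply: ltnW. Qed.

Lemma node_cut p q : p != q -> exists Q : {set 'I_nleaves},
  [/\ forall i j : 'I_nleaves, i \in Q -> j \in Q ->
        eq_turn (node_degree p) (node_turns p i) (node_turns p j),
      forall i j : 'I_nleaves, i \in Q ->
        eq_turn (node_degree p) (node_turns p i) (node_turns p j) -> j \in Q
    & forall i j : 'I_nleaves, i \notin Q -> j \notin Q ->
        eq_turn (node_degree q) (node_turns q i) (node_turns q j)].
Proof.
rewrite -val_eqE /= => npq.
exists [set i : 'I_nleaves | branch (val p) (nth_leaf i) == branch (val p) (val q)].
split=> i j; rewrite !inE !node_eq_turn.
- by move=> /eqP-> /eqP->.
- by move=> /eqP-> /eqP->.
have nqp : val q != val p by rewrite eq_sym.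
by move=> ni nj; rewrite !(@branch_beyond _ (val q) (val p)).
Qed.

Lemma node_median (i j k : 'I_nleaves) : i != j -> j != k -> i != k -> exists p,
  [/\ ~~ eq_turn (node_degree p) (node_turns p i) (node_turns p j),
      ~~ eq_turn (node_degree p) (node_turns p j) (node_turns p k)
    & ~~ eq_turn (node_degree p) (node_turns p i) (node_turns p k)].
Proof.
have ne (a b : 'I_nleaves) : a != b -> nth_leaf a != nth_leaf b.
  by move=> nab; apply: contra nab => /eqP/nth_leaf_inj E; apply/eqP/val_inj/E.
move=> /ne nij /ne njk /ne nik.
have [v [iv n1 n2 n3]] :=
  exists_median (leaf_nth i) (leaf_nth j) (leaf_nth k) nij njk nik.
by exists (Sub v iv); rewrite !node_eq_turn SubK.
Qed.

Definition leaf_branching := Branching node_degree_ge3 node_turns_homo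
  node_turns_le node_cut node_median.
End Numbering.

(** * Arcs, faces and regions *)

Section Arcs.
Variable T : disk_tree.
Implicit Types (u v w x y z c l m : T) (d e : side T) (s : seq T) (p q : {set T}).

Definition leaf_face l : face T := [set d | side_at l d].

Lemma leaf_face_of l d : leaf l -> side_at l d -> face_of d = leaf_face l.
Proof.
move=> ll sd; have [b lb] := leaf_adj ll.
have symA : connect_sym (@side_adjacent T).
  by apply: sym_connect_sym => a a'; rewrite /side_adjacent orbC.
have step a a' : side_next a a' -> side_at l a = side_at l a'.
  by case: a => x y /and3P[/= xy iy /eqP->]; apply: side_at_next.
apply/setP=> e; rewrite !inE; apply/idP/idP=> [/connectP[pth P ->]|se].
  elim: pth d sd P => //= a pth IH d sd /andP[/orP[] /step E]; apply: IH.
    by rewrite -E.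
  by rewrite E.
have sub a : side_at l a -> connect (@side_adjacent T) (l, b) a.
  rewrite -(side_at_walk _ ll lb); apply: connect_sub => {}a a' aa'.
  by apply: connect1; rewrite /side_adjacent aa'.
by apply: connect_trans (sub e se); rewrite symA sub.
Qed.

Lemma leaf_face_in l : leaf l -> leaf_face l \in faces T.
Proof.
move=> ll; have [b lb] := leaf_adj ll.
by rewrite -(leaf_face_of ll (side_at_leaf ll lb)); apply: imset_f; rewrite inE.
Qed.

Lemma facesP F : F \in faces T -> exists2 l, leaf l & F = leaf_face l.
Proof.
case/imsetP=> d; rewrite inE => dd ->; have [l ll sd] := side_at_exists dd.
by exists l; rewrite ?(leaf_face_of ll sd).
Qed.

Lemma leaf_face_inj l l' : leaf l -> leaf l' -> leaf_face l = leaf_face l' -> l = l'.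
Proof.
move=> ll ll' E; have [b lb] := leaf_adj ll; have sl := side_at_leaf ll lb.
apply: (side_at_unique ll ll' sl).
have : (l, b) \in leaf_face l' by rewrite -E inE.
by rewrite inE.
Qed.

(** The edges at [v] on the face of [l] are those towards [l] and towards [next_leaf l]; by
    [branch_at_turn] the second follows the first clockwise, or they coincide. *)
Lemma corner_cw F a v w : F \in faces T -> interior v -> a != w ->
  edge_on F a v -> edge_on F v w -> w = cw v a \/ a = cw v w.
Proof.
case/facesP=> l ll -> iv naw; rewrite /edge_on !inE.
have [b lb] := leaf_adj ll.
have turn := branch_at_turn ll lb iv.
case/orP=> /and3P[/= _ /eqP E1 /eqP E2]; case/orP=> /and3P[/= _ /eqP E3 /eqP E4].
- by case: turn => [E|[_ E]]; [case/eqP: naw; rewrite -E1 -E4 E|left; rewrite -E4 E E1].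
- by case/eqP: naw; rewrite -E1.
- by case/eqP: naw; rewrite -E2.
- by case: turn => [E|[_ E]]; [case/eqP: naw; rewrite -E2 -E3 E|right; rewrite -E2 E E3].
Qed.

Lemma cw_corner a v : adj v a -> interior v ->
  exists2 F, F \in faces T & ((a, v) \in F) && ((v, cw v a) \in F).
Proof.
rewrite adjC => av iv; have [l ll sl] := @side_at_exists T (a, v) av.
by exists (leaf_face l); rewrite ?leaf_face_in // !inE sl -side_at_next.
Qed.

(** For distinct [l] and [m], the vertex set of the path joining them, ends included because
    [branch l l] is [l]. *)
Definition between l m : {set T} := [set z | branch z l != branch z m].

Lemma between_sym l m : between l m = between m l.
Proof. by apply/setP=> z; rewrite !inE eq_sym. Qed.

Lemma between_leaf l m x : leaf l -> leaf m -> leaf x -> l != m ->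
  (x \in between l m) = (x == l) || (x == m).
Proof.
move=> ll lm lx nlm; rewrite inE.
have [->|nxl] := eqVneq x l; first by rewrite branchvv eq_sym branch_neq // eq_sym.
have [->|nxm] := eqVneq x m; first by rewrite branchvv branch_neq.
apply/negbTE; rewrite negbK; apply/eqP/(leaf_adj_eq lx);
  by apply: adj_branch; rewrite eq_sym.
Qed.

Lemma branch_path z w s x : path (@adj T) z (w :: s) -> z \notin w :: s ->
  x \in w :: s -> branch z x = w.
Proof.
move=> /= /andP[zw pth] nz xs; apply: branch_eq zw _.
rewrite (path_avoid nz) in pth; exact: (path_connect pth xs).
Qed.

Lemma branch_split s1 s2 a z w x y : sorted (@adj T) (rcons s1 a ++ z :: w :: s2) ->
  uniq (rcons s1 a ++ z :: w :: s2) ->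
  x \in rcons s1 a -> y \in w :: s2 ->
  [/\ branch z x = a, branch z y = w & a != w].
Proof.
move=> srt unq xs ys; move: (unq); rewrite cat_uniq => /and3P[_ dis /andP[zs2 _]].
have {dis} dis y' : y' \in z :: w :: s2 -> y' \notin rcons s1 a.
  by move=> ys'; apply: contra dis => ?; apply/hasP; exists y'.
have [_ srt2] := cat_sorted2 srt.
have srt1 : path (@adj T) z (a :: rev s1).
  have /cat_sorted2[srt1 _] : sorted (@adj T) (rcons (rcons s1 a) z ++ w :: s2).
    by rewrite cat_rcons.
  rewrite -[path _ _ _]/(sorted (@adj T) (z :: a :: rev s1)) -!rev_rcons rev_sorted.
  by rewrite (@eq_sorted _ _ (@adj T)) // => ? ?; rewrite adjC.
have Ea : a :: rev s1 =i rcons s1 a by move=> t; rewrite -rev_rcons mem_rev.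
split; first by apply: (branch_path srt1); rewrite Ea // dis // mem_head.
  exact: branch_path srt2 zs2 ys.
apply: contraNneq (dis w _) => [<-|]; first by rewrite mem_rcons mem_head.
by rewrite in_cons mem_head orbT.
Qed.

Lemma split_inner l s z : z \in l :: s -> z != l -> z != last l s ->
  exists s1 a w s2, [/\ l :: s = rcons s1 a ++ z :: w :: s2,
                        l \in rcons s1 a & last l s \in w :: s2].
Proof.
move=> zs nzl; rewrite in_cons (negbTE nzl) /= in zs.
case/splitPr: zs => s1 s2; rewrite last_cat /=.
case: s2 => [|w s2] /=; first by rewrite eqxx.
move=> _; exists (belast l s1), (last l s1), w, s2; split.
- by rewrite -lastI.
- by rewrite -lastI mem_head.
- exact: mem_last.
Qed.

Lemma path_between l s : sorted (@adj T) (l :: s) -> uniq (l :: s) -> l != last l s ->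
  [set v in l :: s] = between l (last l s).
Proof.
move=> srt unq nlm; apply/setP=> z; rewrite inE [RHS]inE.
apply/idP/idP=> [zs|]; last first.
  apply: contraNT => nz; apply/eqP/branch_connect; apply/connectP; exists s => //.
  by rewrite -path_avoid.
have [->|nzl] := eqVneq z l; first by rewrite branchvv eq_sym branch_neq // eq_sym.
have [->|nzm] := eqVneq z (last l s); first by rewrite branchvv branch_neq.
have [s1 [a [w [s2 [E l1 m2]]]]] := split_inner zs nzl nzm.
rewrite E in srt unq; have [-> -> //] := branch_split srt unq l1 m2.
Qed.

Lemma acyclic_path_sorted s : acyclic_path s -> sorted (@adj T) s.
Proof.
case: s => // x s [_ H]; apply/(sortedP x) => i lt_i.
by rewrite H //; [rewrite eqxx|apply: ltnW].
Qed.

(* The only repetition allowed by [acyclic_path] is in (a, b, a), whose ends agree. *)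
Lemma acyclic_path_uniq x s : acyclic_path (x :: s) -> x != last x s -> uniq (x :: s).
Proof.
move=> [_ /(_ x) H] nx.
have main i j : i < j -> j < (size s).+1 -> nth x (x :: s) i != nth x (x :: s) j.
  move=> lt_ij lt_j; apply/eqP=> E.
  (* Equal vertices have the same neighbours, so positions [i] and [j] have the same adjacent
     positions; this forces [j = i + 2], with nothing before [i] or after [j]. *)
  have transfer k : k < (size s).+1 ->
      (i.+1 == k) || (k.+1 == i) = ((j.+1 == k) || (k.+1 == j)).
    by move=> lt_k; rewrite -!H ?E //=; apply: ltn_trans lt_j.
  have Ej : j = i.+2.
    have := transfer i.+1 (leq_ltn_trans lt_ij lt_j).
    by move: lt_ij; clear; lia.
  have Es : j = size s.
    apply/eqP; rewrite eqn_leq -ltnS lt_j leqNgt; apply/negP=> lt_js.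
    by have := transfer j.+1 lt_js; move: Ej; clear; lia.
  have Ei : i = 0.
    have lt_i : i.-1 < (size s).+1 by move: lt_ij lt_j; clear; lia.
    by have := transfer i.-1 lt_i; move: Ej; clear; lia.
  by case/eqP: nx; rewrite (last_nth x) -Es -E Ei.
apply/(uniqP x) => i j; rewrite !inE => lt_i lt_j E.
have [lt|lt|//] := ltngtP i j; first by have := main _ _ lt lt_j; rewrite E eqxx.
by have := main _ _ lt lt_i; rewrite E eqxx.
Qed.

Definition near_at v l m :=
  [|| branch v l == branch v m, branch v m == cw v (branch v l) |
      branch v l == cw v (branch v m)].

(** A vertex off the path sees both ends in one branch; at an inner vertex, the two edges of the
    path share a face and [corner_cw] applies. *)
Lemma arc_path_between s : arc_path s -> exists l m,
  [/\ leaf l, leaf m, l != m, [set v in s] = between l m &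
      forall v, interior v -> near_at v l m].
Proof.
case: s => [[[]]//|l s] [acy turns /(_ l)[/= ll lm nlm]].
have unq := acyclic_path_uniq acy nlm; have srt := acyclic_path_sorted acy.
exists l, (last l s); split=> //; first exact: path_between.
move=> v iv; rewrite /near_at; have [//|ne] := eqVneq (branch v l) (branch v (last l s)).
have vs : v \in l :: s.
  have : v \in between l (last l s) by rewrite inE.
  by rewrite -path_between // inE.
have nvl : v != l by rewrite eq_sym interior_neq_leaf.
have nvm : v != last l s by rewrite eq_sym interior_neq_leaf.
have [s1 [a [w [s2 [E l1 m2]]]]] := split_inner vs nvl nvm.
have [F FT /andP[F1 F2]] : exists2 F, F \in faces T & edge_on F a v && edge_on F v w.
  by apply: turns; rewrite E; apply/infixP; exists s1, s2; rewrite cat_rcons.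
rewrite E in srt unq; have [-> -> naw] := branch_split srt unq l1 m2.
by case: (corner_cw FT iv naw F1 F2) => <-; rewrite eqxx ?orbT.
Qed.

Lemma arc_between l m : leaf l -> leaf m -> l != m ->
  (forall v, interior v -> near_at v l m) -> Defs.arc (between l m).
Proof.
move=> ll lm nlm near_lm; have /connectP[p0 pth0 Em] := @dt_connected T l m.
case/shortenP: pth0 Em => p pth unq _ Em.
have srt : sorted (@adj T) (l :: p) by [].
exists (l :: p); last by rewrite Em path_between // -Em.
split.
- split=> // x0; have main i j : i < j -> j < size (l :: p) ->
      adj (nth x0 (l :: p) i) (nth x0 (l :: p) j) = (i.+1 == j).
    move=> lt_ij lt_j; have [<-|ne] := eqVneq i.+1 j.
      by apply: (sortedP x0 _) => //; apply: leq_ltn_trans lt_j.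
    have lt_i2 : i.+2 <= j by rewrite ltn_neqAle ne.
    set s := l :: p in unq srt lt_j *.
    have E : s = rcons (take i s) (nth x0 s i) ++ nth x0 s i.+1 :: nth x0 s i.+2 :: drop i.+3 s.
      rewrite -take_nth; last by move: lt_ij lt_j; clear; lia.
      rewrite -!drop_nth ?cat_take_drop //.
        exact: leq_ltn_trans lt_j.
      by move: lt_i2 lt_j; clear; lia.
    have xi : nth x0 s i \in rcons (take i s) (nth x0 s i).
      by rewrite mem_rcons mem_head.
    have yj : nth x0 s j \in nth x0 s i.+2 :: drop i.+3 s.
      have lt2 : i.+2 < size s by apply: leq_ltn_trans lt_j.
      rewrite -drop_nth // -(subnKC lt_i2) -nth_drop; apply: mem_nth.
      by rewrite size_drop; apply: ltn_sub2r.
    have [] := @branch_split (take i s) (drop i.+3 s) (nth x0 s i) (nth x0 s i.+1)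
      (nth x0 s i.+2) (nth x0 s i) (nth x0 s j) _ _ xi yj; rewrite -?E //.
    (* An edge between positions [i] and [j] would avoid the vertex at [i.+1], which separates its
       ends. *)
    move=> b1 b2 nab; apply: contraNF nab => adj_ij; apply/eqP.
    rewrite -b1 -b2; apply: branch_step adj_ij _ _;
      rewrite nth_uniq ?(ltn_trans lt_ij lt_j) ?(leq_ltn_trans lt_ij lt_j) //;
      by move: lt_ij lt_i2; clear; lia.
  move=> i j lt_i lt_j; have [lt|lt|->] := ltngtP i j.
  - by rewrite main //; move: lt; clear; lia.
  - by rewrite adjC main //; move: lt; clear; lia.
  - by rewrite adjxx; clear; lia.
- move=> u v w /infixP[s1 [s2 E]].
  have E' : l :: p = rcons s1 u ++ v :: w :: s2 by rewrite cat_rcons.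
  have l1 : l \in rcons s1 u.
    by case: s1 E' {E} => [|? ?] [-> _]; rewrite mem_head.
  have m2 : m \in w :: s2.
    by rewrite Em -[last l p]/(last l (l :: p)) E' last_cat /= mem_last.
  rewrite E' in srt unq; have [b1 b2 nuw] := branch_split srt unq l1 m2.
  have [vu vw] : adj v u /\ adj v w.
    move: srt; rewrite cat_rcons; case/cat_sorted2=> _ /= /and3P[uv vw _].
    by rewrite adjC.
  have iv : interior v by apply/negP=> lv; case/eqP: nuw; apply: leaf_adj_eq lv vu vw.
  have := near_lm v iv; rewrite /near_at b1 b2 (negbTE nuw) /=.
  case/orP=> /eqP Ew.
    have [F FT /andP[F1 F2]] := cw_corner vu iv.
    by exists F; rewrite // /edge_on F1 Ew F2.
  have [F FT /andP[F1 F2]] := cw_corner vw iv.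
  by exists F; rewrite // /edge_on F1 Ew F2 !orbT.
- by move=> x0; rewrite /= -Em.
Qed.
End Arcs.

(** * Boundary arcs and the regions of an arc *)

Section Crossing.
Variables (T : disk_tree) (r : T).
Hypothesis leaf_r : leaf r.
Implicit Types (u v w x y z c l m : T) (p q : {set T}) (i j k t : nat).

(** The only leaves on the face of a leaf [z] are [z] and [next_leaf z]. *)
Lemma boundary_between l m : leaf l -> leaf m -> l != m ->
  Defs.arc (between l m) ->
  boundary_arc (between l m) <-> m = next_leaf l \/ l = next_leaf m.
Proof.
move=> ll lm nlm alm; split=> [[_ [F /facesP[z lz ->] on]]|].
  have end_on x : leaf x -> x \in between l m -> x = z \/ x = next_leaf z.
    move=> lx /on /existsP[u /orP[]]; rewrite inE => /and3P[/= adj_xu /eqP E1 /eqP E2].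
      by right; apply/esym/(leaf_branch lx adj_xu).
    by left; apply/esym/(leaf_branch lx _ E1); rewrite adjC.
  have := end_on l ll; have := end_on m lm; rewrite !between_leaf // !eqxx orbT.
  move=> /(_ isT)[Em|Em] /(_ isT)[El|El]; subst=> //; [|by right|by left|];
    by rewrite eqxx in nlm.
have next_on x : leaf x -> Defs.arc (between x (next_leaf x)) ->
    boundary_arc (between x (next_leaf x)).
  move=> lx ax; split=> //; exists (leaf_face x); first exact: leaf_face_in.
  move=> v; rewrite inE => vx; have [b xb] := leaf_adj lx.
  have [->|nvx] := eqVneq v x.
    apply/existsP; exists b; rewrite /edge_on orbC inE.
    by rewrite (side_at_leaf lx xb).
  have nxv : x != v by rewrite eq_sym.
  have vu := adj_branch nxv; apply/existsP; exists (branch v x).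
  rewrite /edge_on inE /side_at /= adjC vu eqxx /= branch_edge; last by rewrite adjC.
  by rewrite eq_sym vx.
case=> E; first by rewrite E in alm *; apply: next_on.
by rewrite between_sym E in alm *; apply: next_on.
Qed.

Notation nth := (nth_leaf r).
Notation n := (nleaves r).

(** The face of leaf [k] meets the boundary of the disk between leaves [k] and [k + 1], so the faces
    [i] to [j - 1] lie on one side of the arc from leaf [i] to leaf [j]. *)
Definition inside i j k := i <= k < j.

(** With only one rise and one fall available, [s i = s j] makes the stretch from [i] to [j] contain
    both or neither. *)
Lemma ascent_descent (s : nat -> bool) (a b i j m : nat) : i < j -> j <= m -> s i = s j ->
  ~~ s a -> s a.+1 -> s b -> ~~ s b.+1 ->
  (forall k, k < m -> ~~ s k -> s k.+1 -> k = a) ->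
  (forall k, k < m -> s k -> ~~ s k.+1 -> k = b) ->
  inside i j a = inside i j b.
Proof.
move=> lt_ij le_jm Es a0 a1 b1 b0 up down.
have const (f : nat -> bool) (k k' : nat) : k <= k' -> k' <= j ->
    (forall t, k <= t < k' -> f t -> f t.+1) -> f k -> f k'.
  move=> /subnKC <-; elim: (k' - k) => [|e IH]; first by rewrite addn0.
  rewrite addnS => lt_j step fk; apply: (step); first by clear; lia.
  apply: IH fk => //; first exact: ltnW.
  by move=> t tk; apply: step; move: tk; clear; lia.
apply/idP/idP=> /andP[le_i lt_j]; apply: contraT => out.
  have step t : i <= t < j -> s t -> s t.+1.
    move=> /andP[it tj] st; apply: contraT => nst.
    have Et : t = b by apply: down => //; apply: leq_trans le_jm.
    by rewrite -Et /inside it tj in out.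
  have sj : s j.
    apply: const a1 => // t /andP[at' tj]; apply: step; rewrite tj andbT.
    by apply: leq_trans le_i _; apply: ltnW.
  case/negP: a0; apply: (const s i a) => //; [exact: ltnW| |by rewrite Es].
  by move=> t /andP[it ta]; apply: step; rewrite it (ltn_trans ta).
have step t : i <= t < j -> ~~ s t -> ~~ s t.+1.
  move=> /andP[it tj] st; apply/negP => nst.
  have Et : t = a by apply: up => //; apply: leq_trans le_jm.
  by rewrite -Et /inside it tj in out.
have sj : ~~ s j.
  apply: (const (fun t => ~~ s t)) b0 => // t /andP[at' tj]; apply: step; rewrite tj andbT.
  by apply: leq_trans le_i _; apply: ltnW.
have : ~~ s b; last by rewrite b1.
apply: (const (fun t => ~~ s t) i b) => //; [exact: ltnW| |by rewrite Es].
by move=> t /andP[it tb]; apply: step; rewrite it (ltn_trans tb).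
Qed.

(** The numbers of the two faces at an edge are the places where the contour enters and leaves the
    part of the tree beyond it. If the edge is not on the arc, leaves [i] and [j] are in the same
    part. *)
Lemma face_crossing_inside (i j a b : nat) : i < j -> j < n -> a < n -> b < n ->
  face_crossing (between (nth i) (nth j)) (leaf_face (nth a)) (leaf_face (nth b)) ->
  inside i j a = inside i j b.
Proof.
move=> lt_ij lt_j lt_a lt_b /and3P[_ _ /existsP[[x y] /and4P[/= xy off]]].
rewrite [in X in X -> _]inE [in X in _ -> X -> _]inE => sa sb.
have ln k := leaf_nth leaf_r k.
pose s k := branch x (nth k) == y.
have sE k : s k = (branch y (nth k) != x) by apply: branch_edge.
have upP k : side_at (nth k) (x, y) = ~~ s k && s k.+1.
  by rewrite sE negbK /side_at /= xy.
have downP k : side_at (nth k) (y, x) = s k && ~~ s k.+1.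
  by rewrite (sE k.+1) negbK /side_at /= adjC xy.
have /andP[a0 a1] := sa; have {a0 a1} /andP[a0 a1] : ~~ s a && s a.+1 by rewrite -upP.
have /andP[b0 b1] : s b && ~~ s b.+1 by rewrite -downP.
apply: (ascent_descent (m := n) lt_ij (ltnW lt_j) _ a0 a1 b0 b1).
- apply: contraNeq off => ne; rewrite !inE.
  have n1 : branch x (nth i) != branch x (nth j).
    by apply: contra ne => /eqP E; rewrite /s E.
  have n2 : branch y (nth i) != branch y (nth j).
    by apply: contra ne => /eqP E; rewrite !sE E.
  by rewrite n1.
- move=> k lt_k k0 k1; apply: (nth_leaf_inj lt_k lt_a).
  by apply: side_at_unique (ln k) (ln a) _ sa; rewrite upP k0.
- move=> k lt_k k0 k1; apply: (nth_leaf_inj lt_k lt_b).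
  by apply: side_at_unique (ln k) (ln b) _ sb; rewrite downP k0.
Qed.

(** The edge to cross is the pendant edge of leaf [k + 1]. *)
Lemma face_crossing_next i j k : nth i != nth j ->
  nth k.+1 != nth i -> nth k.+1 != nth j ->
  face_crossing (between (nth i) (nth j)) (leaf_face (nth k)) (leaf_face (nth k.+1)).
Proof.
move=> nij ni nj; have ln t := leaf_nth leaf_r t.
rewrite /face_crossing (leaf_face_in (ln k)) (leaf_face_in (ln k.+1)) !andTb.
have [b mb] := leaf_adj (ln k.+1); apply/existsP; exists (b, nth k.+1).
have bm : adj b (nth k.+1) by rewrite adjC.
apply/and4P; split; rewrite ?[_ \in leaf_face _]inE //.
- rewrite negb_and (between_leaf (ln i) (ln j) (ln k.+1) nij).
  by rewrite (negbTE ni) (negbTE nj) orbT.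
- apply/and3P; split=> //; last by rewrite -nth_leafS branch_adj.
  apply/eqP/(leaf_adj_eq (ln k.+1)) => //.
  by apply: adj_branch; rewrite eq_sym next_leaf_neq.
- by have := side_at_leaf (ln k.+1) mb; rewrite ?inE.
Qed.

Lemma face_crossing_sym p : symmetric (face_crossing p).
Proof.
move=> F G; suff W F' G' : face_crossing p F' G' -> face_crossing p G' F'.
  by apply/idP/idP; apply: W.
case/and3P=> F1 G1 /existsP[[x y] /and4P[/= xy off f g]].
rewrite /face_crossing F1 G1; apply/existsP; exists (y, x) => /=.
by rewrite f g adjC xy andbC [(y \in p) && _]andbC off.
Qed.

Lemma face_chain (i j a b : nat) : nth i != nth j -> a <= b ->
  (forall k, a < k <= b -> nth k != nth i /\ nth k != nth j) ->
  connect (face_crossing (between (nth i) (nth j)))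
    (leaf_face (nth a)) (leaf_face (nth b)).
Proof.
move=> nij /subnKC <-; elim: (b - a) => [|e IH] H; first by rewrite addn0.
apply: connect_trans (IH _) _.
  by move=> k /andP[ak kb]; apply: H; rewrite ak addnS ltnW.
have [|n1 n2] := H (a + e.+1); first by clear; lia.
by rewrite addnS in n1 n2 *; apply/connect1/face_crossing_next.
Qed.

Lemma nth_neq i j : i < n -> j < n -> i != j -> nth i != nth j.
Proof. by move=> lt_i lt_j; apply: contra => /eqP/nth_leaf_inj E; apply/eqP/E. Qed.

Lemma inside_connect (i j a b : nat) : i < j -> j < n -> a < n -> b < n ->
  inside i j a = inside i j b ->
  connect (face_crossing (between (nth i) (nth j)))
    (leaf_face (nth a)) (leaf_face (nth b)).
Proof.
move=> lt_ij lt_j.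
wlog le_ab : a b / a <= b.
  move=> W lt_a lt_b E; have [|/ltnW] := leqP a b; first by move/W; apply.
  move/W => /(_ lt_b lt_a (esym E)).
  by rewrite (sym_connect_sym (face_crossing_sym _)).
move=> lt_a lt_b E; have lt_i := ltn_trans lt_ij lt_j.
have nij : nth i != nth j by rewrite nth_neq // neq_ltn lt_ij.
have far k : k < n -> k != i -> k != j -> nth k != nth i /\ nth k != nth j.
  by move=> *; split; apply: nth_neq.
(* Between a face before [i] and one from [j] on, the chain must avoid leaves [i] and [j] by going
   around through leaf [n], which is leaf [0]. *)
have [/andP[lt_ai le_jb]|mid] := boolP ((a < i) && (j <= b)); last first.
  apply: face_chain => // k /andP[ak kb]; apply: far.
  - exact: leq_ltn_trans lt_b.
  - by move: E mid ak kb lt_ij; rewrite /inside; clear; lia.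
  - by move: E mid ak kb lt_ij; rewrite /inside; clear; lia.
rewrite (sym_connect_sym (face_crossing_sym _)).
apply: (@connect_trans _ _ (leaf_face (nth n))).
  apply: face_chain => // [|k /andP[bk]]; first exact: ltnW.
  rewrite leq_eqVlt => /orP[/eqP->|lt_k].
    rewrite nth_leaf_last -[r]/(nth 0); apply: far.
    - exact: leq_ltn_trans lt_a.
    - by move: lt_ai; clear; lia.
    - by move: lt_ij; clear; lia.
  by apply: far => //; move: bk le_jb lt_ij; clear; lia.
rewrite nth_leaf_last -[leaf_face r]/(leaf_face (nth 0)).
apply: face_chain => // k /andP[k0 ka]; apply: far.
- exact: leq_ltn_trans lt_a.
- by move: ka lt_ai; clear; lia.
- by move: ka lt_ai lt_ij; clear; lia.
Qed.

Lemma faces_nth F : F \in faces T -> exists2 k, k < n & F = leaf_face (nth k).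
Proof. by case/facesP=> l /(nth_leaf_surj leaf_r)[k lt_k ->] ->; exists k. Qed.

Lemma region_of_nth (i j a : nat) : i < j -> j < n -> a < n ->
  region_of (between (nth i) (nth j)) (leaf_face (nth a)) =
  [set leaf_face (nth b) | b : 'I_n & inside i j b == inside i j a].
Proof.
move=> lt_ij lt_j lt_a; apply/setP=> G; rewrite inE.
apply/idP/imsetP=> [/connectP[pth P ->]|[b] /[!inE] /eqP Eb ->]; last first.
  exact: inside_connect.
elim: pth a lt_a P => [|F pth IH] a lt_a /= => [_|/andP[aF P]].
  by exists (Ordinal lt_a); rewrite ?inE.
have /and3P[_ /faces_nth[k lt_k Ek] _] := aF; rewrite Ek in aF P *.
have [b /[!inE] /eqP Eb ->] := IH k lt_k P; exists b => //.
by rewrite inE Eb (face_crossing_inside lt_ij lt_j lt_a lt_k aF).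
Qed.
End Crossing.

(** * Crossing arcs as interleaving chords *)

Section Transfer.
Variables (T : disk_tree) (r : T).
Hypothesis leaf_r : leaf r.
Implicit Types (u v w x y z c m : T) (p q : {set T}).

Notation nth := (nth_leaf r).
Notation n := (nleaves r).
Notation B := (leaf_branching leaf_r).

Implicit Types i j k l : 'I_n.

Lemma admissibleP i j : reflect
  (forall v, interior v -> near_at v (nth i) (nth j)) (admissible B i j).
Proof.
have E (v : interior_vertex T) : near (v : node B) i j = near_at (val v) (nth i) (nth j).
  by apply: near_turn_branch (valP v) _ _; rewrite // ltnW.
apply: (iffP forallP) => H v; last by rewrite E; apply: H (valP v).
by move=> iv; have := H (Sub v iv); rewrite E SubK.
Qed.

Lemma same_branchE (v : interior_vertex T) i j :
  same (v : node B) i j = (branch (val v) (nth i) == branch (val v) (nth j)).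
Proof. exact: node_eq_turn. Qed.

(** The branch [c] contains two distinct leaves, so [c] is not a leaf and the edge [m], [c] is a
    segment. *)
Lemma shared_edge_toward (a a' b b' m : T) : leaf a -> leaf b -> a != b ->
  interior m -> branch m a = branch m b ->
  branch m a' != branch m a -> branch m b' != branch m a ->
  let c := branch m a in
  [/\ adj m c, interior m & interior c] /\
  [/\ m \in between a a', c \in between a a', m \in between b b' & c \in between b b'].
Proof.
move=> la lb nab im E na nb c.
have mc : adj m c by apply/adj_branch/interior_neq_leaf.
have cm : adj c m by rewrite adjC.
have Ea : branch c a != m by rewrite branch_edge // eqxx.
have Eb : branch c b != m by rewrite branch_edge // -E eqxx.
have Ea' : branch c a' = m by apply/eqP; rewrite branch_edge.
have Eb' : branch c b' = m by apply/eqP; rewrite branch_edge.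
have ic : interior c.
  apply/negP=> lc; case/eqP: nab.
  by rewrite (leaf_branch lc mc (erefl c)) (leaf_branch lc mc (esym E)).
by split; split; rewrite // inE ?Ea' ?Eb' -?E // eq_sym.
Qed.

(** At the median of [i], [j] and [k], leaf [k] is in neither branch of the ends [i] and [j], so by
    [near_half] leaf [l], on the other side of the chord, is in one of them. The paths share the
    edge into that branch. *)
Lemma interleave_shared_edge i j k l : interleave i j k l -> admissible B i j ->
  exists m c, [/\ adj m c, interior m & interior c] /\
    [/\ m \in between (nth i) (nth j), c \in between (nth i) (nth j),
        m \in between (nth k) (nth l) & c \in between (nth k) (nth l)].
Proof.
move=> X aij.
have [nij nik njk nil njl] : [/\ i != j, i != k, j != k, i != l & j != l].
  by split; apply: contraTneq X => ->; rewrite /interleave /cyc; clear; lia.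
have [v [sij sjk sik]] := branch_median B nij njk nik.
have {sij sjk sik} [nsij nskj nski] :
    [/\ ~~ same v i j, ~~ same v k j & ~~ same v k i].
  by split=> //; rewrite same_sym.
have sl : same v l i || same v l j.
  have asym s t : cyc s k t && cyc t l s || cyc s l t && cyc t k s ->
      (forall x : 'I_n, ~~ cyc t x s -> same v x i || same v x j) ->
      same v l i || same v l j.
    case/orP=> /andP[C1 C2] H; last by apply: H; move: C1; rewrite /cyc; clear; lia.
    have : same v k i || same v k j by apply: H; move: C1; rewrite /cyc; clear; lia.
    by rewrite (negbTE nskj) (negbTE nski).
  case: (near_half nij (forallP aij v)) => H; first exact: asym X H.
  by apply: asym H; move: X; rewrite /interleave orbC andbC [cyc j l i && _]andbC.
have iv := valP v; rewrite !same_branchE in nsij nskj nski sl.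
have ne (s t : 'I_n) : s != t -> nth s != nth t.
  exact: (nth_neq (ltn_ord s) (ltn_ord t)).
have ln s : leaf (nth s) by apply: leaf_nth.
have nli : l != i by rewrite eq_sym.
have nlj : l != j by rewrite eq_sym.
case/orP: sl => /eqP E.
  exists (val v), (branch (val v) (nth i)).
  have [||c1 [c2 c3 c4 c5]] := @shared_edge_toward (nth i) (nth j) (nth l) (nth k) (val v)
    (ln i) (ln l) (ne _ _ nil) iv (esym E).
  - by rewrite eq_sym.
  - by [].
  by split=> //; split=> //; rewrite between_sym.
exists (val v), (branch (val v) (nth j)).
have [||c1 [c2 c3 c4 c5]] := @shared_edge_toward (nth j) (nth i) (nth l) (nth k) (val v)
  (ln j) (ln l) (ne _ _ njl) iv (esym E).
- by [].
- by [].
by split=> //; split=> //; rewrite between_sym.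
Qed.

(** Since the intervals are half-open, the four ends themselves serve as witnesses. *)
Lemma inside_all (i j k l : nat) (a b : bool) : interleave i j k l ->
  i < j -> j < n -> k < l -> l < n ->
  exists2 t, t < n & inside i j t = a /\ inside k l t = b.
Proof.
move=> X lt_ij lt_j lt_kl lt_l.
have [/andP[lt_ik /andP[lt_kj lt_jl]]|H] := boolP ((i < k) && ((k < j) && (j < l))).
  exists (if a then (if b then k else i) else (if b then j else l)).
    by case: a b => -[]; move: lt_ij lt_kj lt_j lt_l lt_jl; clear; lia.
  by case: a b => -[]; rewrite /inside; move: lt_ik lt_kj lt_jl; clear; lia.
have {H X} /andP[lt_ki /andP[lt_il lt_lj]] : (k < i) && ((i < l) && (l < j)).
  by move: X H lt_ij lt_kl; rewrite /interleave /cyc; clear; lia.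
exists (if b then (if a then i else k) else (if a then l else j)).
  by case: a b => -[]; move: lt_ij lt_ki lt_j lt_l lt_lj; clear; lia.
by case: a b => -[]; rewrite /inside; move: lt_ki lt_il lt_lj; clear; lia.
Qed.

(** The intervals are disjoint or nested; each case names a region of the first chord contained in
    one of the second. *)
Lemma inside_some (i j k l : nat) : ~~ interleave i j k l -> i < j -> k < l ->
  exists a b, forall t, inside i j t = a -> inside k l t = ~~ b -> False.
Proof.
move=> X lt_ij lt_kl.
suff [a [b H]] : exists a b, forall t, ~~ ((inside i j t == a) && (inside k l t == ~~ b)).
  by exists a, b => t E1 E2; have := H t; rewrite E1 E2 !eqxx.
have : [|| j <= k, l <= i, (i <= k) && (l <= j) | (k <= i) && (j <= l)].
  by move: X lt_ij lt_kl; rewrite /interleave /cyc; clear; lia.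
case/or4P=> H; [exists true, false|exists true, false|exists false, false|exists true, true];
  move=> t; rewrite /inside; move: H; clear; lia.
Qed.

Lemma regions_nth (i j : nat) R : i < j -> j < n -> R \in regions (between (nth i) (nth j)) ->
  exists a : bool, R = [set leaf_face (nth t) | t : 'I_n & inside i j t == a].
Proof.
move=> lt_ij lt_j /imsetP[F /(faces_nth leaf_r)[t lt_t ->] ->].
by exists (inside i j t); apply: region_of_nth.
Qed.

Lemma regions_nth_in (i j : nat) (a : bool) : i < j -> j < n ->
  [set leaf_face (nth t) | t : 'I_n & inside i j t == a] \in
    regions (between (nth i) (nth j)).
Proof.
move=> lt_ij lt_j; pose t := if a then i else j.
have lt_t : t < n by rewrite /t; case: (a) => //; apply: ltn_trans lt_j.
have -> : a = inside i j t.
  by rewrite /t /inside; case: (a); rewrite ?leqnn ?lt_ij ?ltnn ?andbF.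
rewrite -region_of_nth //; apply/imset_f/leaf_face_in; exact: leaf_nth.
Qed.

Lemma leaf_face_nth_in (t : 'I_n) (f : pred 'I_n) :
  (leaf_face (nth t) \in [set leaf_face (nth t') | t' : 'I_n & f t']) = f t.
Proof.
apply/imsetP/idP=> [[t' /[!inE] ft' E]|ft]; last by exists t; rewrite ?inE.
have := leaf_face_inj (leaf_nth leaf_r t) (leaf_nth leaf_r t') E.
by move/(nth_leaf_inj (ltn_ord t) (ltn_ord t'))/val_inj=> ->.
Qed.

Lemma not_interleave_noncrossing i j k l : i < j -> k < l -> ~~ interleave i j k l ->
  noncrossing (between (nth i) (nth j)) (between (nth k) (nth l)).
Proof.
move=> lt_ij lt_kl X s [_ _ _ H].
have [a [b E]] := inside_some X lt_ij lt_kl.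
have [+ _] := H _ _ (regions_nth_in a lt_ij (ltn_ord j)) (regions_nth_in b lt_kl (ltn_ord l)).
case/negP; apply/subsetP=> F /imsetP[t /[!inE] /eqP Ea ->].
rewrite (leaf_face_nth_in t (fun t' => inside k l t' == b)).
apply: contraT => Eb; case: (E t Ea).
by move: Eb; case: (b) (inside _ _ _) => -[].
Qed.

(** The segment is one shared edge, for which the condition on consecutive edges is vacuous;
    [inside_all] makes the regions incomparable. *)
Lemma interleave_crossing i j k l : i < j -> k < l -> interleave i j k l ->
  admissible B i j ->
  exists s, cross_along (between (nth i) (nth j)) (between (nth k) (nth l)) s.
Proof.
move=> lt_ij lt_kl X aij.
have [m [c [[mc im ic] [m1 c1 m2 c2]]]] := interleave_shared_edge X aij.
exists [:: m; c]; split.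
- split=> //.
  + split=> // x0 [|[|i']] [|[|j']] //= _ _; rewrite ?adjxx ?mc // adjC mc //.
  + by move=> u v w /size_infix.
- by move=> x; rewrite in_cons mem_seq1 => /orP[] /eqP->.
- by move=> x; rewrite in_cons mem_seq1 => /orP[] /eqP->.
move=> R R' /(regions_nth lt_ij (ltn_ord j))[a ->] /(regions_nth lt_kl (ltn_ord l))[b ->].
have four := fun a b => inside_all a b X lt_ij (ltn_ord j) lt_kl (ltn_ord l).
split; apply/negP=> /subsetP sub.
  have [t lt_t [Ea Eb]] := four a (~~ b).
  have := sub (leaf_face (nth t)); rewrite -[t]/(val (Ordinal lt_t)).
  rewrite (leaf_face_nth_in (Ordinal lt_t) (fun t' => inside i j t' == a)).
  rewrite (leaf_face_nth_in (Ordinal lt_t) (fun t' => inside k l t' == b)) /= Ea Eb eqxx.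
  by case: (b) => /(_ isT).
have [t lt_t [Ea Eb]] := four (~~ a) b.
have := sub (leaf_face (nth t)); rewrite -[t]/(val (Ordinal lt_t)).
rewrite (leaf_face_nth_in (Ordinal lt_t) (fun t' => inside i j t' == a)).
rewrite (leaf_face_nth_in (Ordinal lt_t) (fun t' => inside k l t' == b)) /= Ea Eb eqxx.
by case: (a) => /(_ isT).
Qed.
End Transfer.

(** * The reduced complex as a complex of dissections *)

Section Chord_model.
Variables (T : disk_tree) (r : T).
Hypothesis leaf_r : leaf r.
Implicit Types (u v w x y z c m : T) (p q : {set T}).

Notation nth := (nth_leaf r).
Notation n := (nleaves r).
Notation B := (leaf_branching leaf_r).
Implicit Types i j k l : 'I_n.

(** The ends are in increasing order, as the description of regions by intervals requires. *)
Definition chord_arc (e : 'I_n * 'I_n) p :=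
  [&& e.1 < e.2, diagonal setT e.1 e.2, admissible B e.1 e.2 &
      p == between (nth e.1) (nth e.2)].

Definition inner_arcs : {set {set T}} := [set p | [exists e, chord_arc e p]].

Definition arc_ends p : 'I_n * 'I_n :=
  let o := Ordinal (order_gt0 (@next_leaf T) r) in
  odflt (o, o) [pick e | chord_arc e p].

Definition arc_start p := (arc_ends p).1.
Definition arc_end p := (arc_ends p).2.

Lemma arc_endsP p : p \in inner_arcs -> chord_arc (arc_ends p) p.
Proof.
rewrite inE /arc_ends; case: pickP => [e|none] //= /existsP[e].
by rewrite none.
Qed.

Lemma inner_arcP p : p \in inner_arcs ->
  [/\ arc_start p < arc_end p, diagonal setT (arc_start p) (arc_end p),
      admissible B (arc_start p) (arc_end p) &
      p = between (nth (arc_start p)) (nth (arc_end p))].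
Proof. by move=> /arc_endsP/and4P[? ? ? /eqP]. Qed.

Lemma nth_neqP i j : i != j -> nth i != nth j.
Proof. exact: (nth_neq (ltn_ord i) (ltn_ord j)). Qed.

Lemma between_inj i j k l : i != j -> k != l ->
  between (nth i) (nth j) = between (nth k) (nth l) -> same_ends i j k l.
Proof.
move=> /[dup] ij /nth_neqP nij /nth_neqP nkl E.
have ln s : leaf (nth s) by apply: leaf_nth.
have val_nth (s t : 'I_n) : (nth s == nth t) = (s == t).
  by apply/eqP/eqP=> [/(nth_leaf_inj (ltn_ord s) (ltn_ord t))/val_inj|->].
have := between_leaf (ln k) (ln l) (ln i) nkl.
have := between_leaf (ln k) (ln l) (ln j) nkl.
rewrite -E !between_leaf // !eqxx orbT !val_nth /same_ends.
move: ij; rewrite -!val_eqE /=; clear; lia.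
Qed.

Lemma inner_arcs_admissible p : p \in inner_arcs ->
  admissible B (arc_start p) (arc_end p).
Proof. by case/inner_arcP. Qed.

Lemma inner_arcs_diagonal p : p \in inner_arcs ->
  diagonal setT (arc_start p) (arc_end p).
Proof. by case/inner_arcP. Qed.

Lemma inner_arcs_inj p q : p \in inner_arcs -> q \in inner_arcs ->
  same_ends (arc_start p) (arc_end p) (arc_start q) (arc_end q) -> p = q.
Proof.
move=> /inner_arcP[_ _ _ Ep] /inner_arcP[_ _ _ Eq] same_pq.
apply: etrans Ep (etrans _ (esym Eq)).
by case/orP: same_pq => /andP[/eqP-> /eqP->] //; apply: between_sym.
Qed.

Lemma inner_arcs_surj i j : diagonal setT i j -> admissible B i j ->
  exists2 p, p \in inner_arcs & same_ends i j (arc_start p) (arc_end p).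
Proof.
move=> dij aij; have nij := diagonal_neq dij.
have pA : between (nth i) (nth j) \in inner_arcs.
  rewrite inE; have [lt_ij|lt_ji|/val_inj E] := ltngtP i j.
  - by apply/existsP; exists (i, j); apply/and4P.
  - apply/existsP; exists (j, i); apply/and4P; split=> //=.
    + by rewrite diagonal_sym.
    + by rewrite admissible_sym.
    + by rewrite between_sym.
  - by rewrite E eqxx in nij.
exists (between (nth i) (nth j)) => //.
have [_ d _ E] := inner_arcP pA; exact: between_inj nij (diagonal_neq d) E.
Qed.

(** For [i < j], being a diagonal of the full polygon excludes exactly [j = i + 1] and the pair [0],
    [n - 1]: the pairs of successive leaves. *)
Lemma inner_arcsE p : p \in inner_arcs <-> Defs.arc p /\ ~ boundary_arc p.
Proof.
have ln s : leaf (nth s) by apply: leaf_nth.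
have bnd (i j : 'I_n) : i < j -> Defs.arc (between (nth i) (nth j)) ->
    boundary_arc (between (nth i) (nth j)) <->
    (j == i.+1 :> nat) || (i == 0 :> nat) && (j.+1 == n).
  move=> lt_ij ap; have nij : nth i != nth j.
    by apply: nth_neqP; rewrite -val_eqE neq_ltn lt_ij.
  apply: (iff_trans (boundary_between (ln i) (ln j) nij ap)).
  split=> [[E|E]|/orP[/eqP->|/andP[/eqP-> /eqP E]]].
  - by rewrite (nth_leaf_inj (ltn_ord j) (leq_ltn_trans lt_ij (ltn_ord j)) E) eqxx.
  - move: (ltn_ord j); rewrite leq_eqVlt => /orP[/eqP En|lt_j].
      rewrite En eqxx andbT; rewrite -nth_leafS En nth_leaf_last in E.
      have n0 : 0 < n by apply: leq_ltn_trans (ltn_ord i).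
      by rewrite (nth_leaf_inj (ltn_ord i) n0 E) eqxx orbT.
    have Ei := nth_leaf_inj (ltn_ord i) lt_j E.
    by move: Ei lt_ij; clear; lia.
  - by left; rewrite nth_leafS.
  - by right; rewrite -nth_leafS E nth_leaf_last.
split.
  case/inner_arcP; set i := arc_start p; set j := arc_end p => lt_ij d a ->.
  have ap : Defs.arc (between (nth i) (nth j)).
    by apply: arc_between (ln i) (ln j) (nth_neqP (diagonal_neq d)) _; apply/admissibleP/a.
  split=> // /(bnd i j lt_ij ap) H; case/and4P: d => _ _.
  case/exists_inP=> k _ c1 /exists_inP[l _ c2].
  by move: H c1 c2 (ltn_ord k) (ltn_ord l); rewrite /cyc; clear; lia.
case=> ap nb; case: (ap) => s ps Ep; have [l [m [ll lm nlm E near_lm]]] := arc_path_between ps.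
rewrite -Ep in E; have [i0 lt_i Ei] := nth_leaf_surj leaf_r ll.
have [j0 lt_j Ej] := nth_leaf_surj leaf_r lm.
wlog lt_ij : l m i0 j0 lt_i lt_j Ei Ej E nlm near_lm ll lm / i0 < j0.
  move=> W; have [lt|lt|eq_ij] := ltngtP i0 j0; first exact: (W l m i0 j0).
    apply: (W m l j0 i0) => //; first by rewrite between_sym.
      by rewrite eq_sym.
    move=> v /near_lm; rewrite /near_at eq_sym; case: (_ == _) => //=.
    by rewrite orbC.
  by rewrite Ei Ej eq_ij eqxx in nlm.
pose i := Ordinal lt_i; pose j := Ordinal lt_j.
have Ep' : p = between (nth i) (nth j) by rewrite E Ei Ej.
rewrite inE; apply/existsP; exists (i, j); apply/and4P; split=> //=; last by apply/eqP.
  have {}nb : ~~ ((j == i.+1 :> nat) || (i == 0 :> nat) && (j.+1 == n)).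
    by apply/negP=> /(bnd i j lt_ij) H; apply: nb; rewrite Ep'; apply: H; rewrite -Ep'.
  move: nb; rewrite /= => nb; apply/and4P; split; rewrite ?inE //; apply/exists_inP.
    have lt_k : i0.+1 < n by exact: (leq_ltn_trans lt_ij (ltn_ord j)).
    by exists (Ordinal lt_k); rewrite ?inE // /cyc /=; move: nb lt_ij; clear; lia.
  have [i_0|i_gt0] := posnP i0.
    have lt_k : j0.+1 < n by move: nb (ltn_ord j); rewrite /= i_0; clear; lia.
    by exists (Ordinal lt_k); rewrite ?inE // /cyc /=; move: lt_ij; clear; lia.
  have lt_k : i0.-1 < n by move: (ltn_ord i); rewrite /=; clear; lia.
  by exists (Ordinal lt_k); rewrite ?inE // /cyc /=; move: lt_ij i_gt0; clear; lia.
by apply/admissibleP=> v iv; rewrite /= -Ei -Ej; apply: near_lm.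
Qed.

Lemma reduced_noncrossing_complexE (S : {set {set T}}) :
  reduced_noncrossing_complex S <-> dissection inner_arcs arc_start arc_end S.
Proof.
split=> [[[arcS ncS] nbS]|[/subsetP sS ncS]].
  have sA p : p \in S -> p \in inner_arcs.
    by move=> pS; apply/inner_arcsE; split; [apply: arcS|apply: nbS].
  split=> [|p q pS qS]; first exact/subsetP.
  apply/negP=> X; have npq : p != q.
    by apply: contraTneq X => ->; apply: crossesxx.
  have [lt_p _ a_p Ep] := inner_arcP (sA p pS).
  have [lt_q _ _ Eq] := inner_arcP (sA q qS).
  have [s] := interleave_crossing lt_p lt_q X a_p.
  by rewrite -Ep -Eq; apply: ncS.
split=> [|p /sS/inner_arcsE[]//]; split=> [p /sS/inner_arcsE[]//|p q pS qS _].
have [lt_p _ a_p Ep] := inner_arcP (sS p pS).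
have [lt_q _ _ Eq] := inner_arcP (sS q qS).
rewrite Ep Eq; apply: (not_interleave_noncrossing leaf_r lt_p lt_q).
exact: ncS.
Qed.

(** From one leaf to the next, the branch at an interior vertex turns at most once, so the sides are
    admissible. *)
Lemma leaves_polygon : 2 < n -> polygon B setT.
Proof.
move=> n3; split; first by rewrite cardsT card_ord.
move=> i j /and4P[_ _ nij /forall_inP between_ij].
have E : nth j = next_leaf (nth i).
  rewrite -nth_leafS; move: (ltn_ord i); rewrite leq_eqVlt => /orP[/eqP Ei|lt_i].
    rewrite Ei nth_leaf_last -[r]/(nth 0); congr nth.
    have n0 : 0 < n by apply: ltn_trans n3.
    have := between_ij (Ordinal n0); rewrite inE => /(_ isT).
    move: nij Ei (ltn_ord j); rewrite -val_eqE /cyc /=; clear; lia.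
  congr nth; have := between_ij (Ordinal lt_i); rewrite inE => /(_ isT).
  by move: nij; rewrite -val_eqE /cyc /=; clear; lia.
apply/admissibleP=> v iv; rewrite /near_at E.
have [b ib] := leaf_adj (leaf_nth leaf_r i).
by case: (branch_at_turn (leaf_nth leaf_r i) ib iv) => [->|[_ ->]]; rewrite eqxx ?orbT.
Qed.

Lemma dissection_inner_arcs :
  pure (dissection inner_arcs arc_start arc_end) /\
  thin (dissection inner_arcs arc_start arc_end).
Proof.
have [n3|n2] := ltnP 2 n.
  exact: (dissection_pure_thin inner_arcs_admissible inner_arcs_inj
    inner_arcs_surj inner_arcs_diagonal (leaves_polygon n3)).
(* With at most two leaves the empty set is the only simplex, and no simplex has codimension 1. *)
have noarc S : dissection inner_arcs arc_start arc_end S -> S = set0.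
  case=> /subsetP sS _; apply/eqP; rewrite -subset0; apply/subsetP=> p /sS.
  case/inner_arcP=> _ /and4P[_ _ /exists_inP[k _ c1] /exists_inP[l _ c2]] _ _.
  move: c1 c2 (ltn_ord k) (ltn_ord l) (ltn_ord (arc_start p)) (ltn_ord (arc_end p)).
  by move: n2; rewrite /cyc; clear; lia.
split=> [F F' [/noarc-> _] [/noarc-> _] //|S [/noarc-> [F /noarc-> cF] _]].
by rewrite cards0 in cF.
Qed.

End Chord_model.

(** Complexes are predicates that are equivalent rather than equal, so facets, purity and thinness
    are transported along the equivalence. *)
Lemma facet_iff (X : finType) (D D' : {set X} -> Prop) :
  (forall S, D S <-> D' S) -> forall F, facet D F <-> facet D' F.
Proof.
by move=> E F; split=> -[/E dF maxF]; split=> // S /E; apply: maxF.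
Qed.

Lemma pure_iff (X : finType) (D D' : {set X} -> Prop) :
  (forall S, D S <-> D' S) -> pure D -> pure D'.
Proof.
move=> E pD F F' /(facet_iff E) fF /(facet_iff E) fF'; exact: pD.
Qed.

Lemma thin_iff (X : finType) (D D' : {set X} -> Prop) :
  (forall S, D S <-> D' S) -> thin D -> thin D'.
Proof.
move=> E tD S [/E dS [F /E dF cF] maxS].
have [|F1 [F2 [nF H]]] := tD S.
  by split=> //; [exists F|move=> G /E; apply: maxS].
exists F1, F2; split=> // G; rewrite -H.
by split=> -[/(facet_iff E)].
Qed.

Theorem corollary3p10 (T : disk_tree) :
  pure (@reduced_noncrossing_complex T) /\
  thin (@reduced_noncrossing_complex T).
Proof.
have [r leaf_r] := exists_leaf T.
have E S := iff_sym (reduced_noncrossing_complexE leaf_r S).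
have [pD tD] := dissection_inner_arcs leaf_r.
by split; [apply: pure_iff E pD|apply: thin_iff E tD].
Qed.
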